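(* Consider the complete binary tree of depth $m$ with the Gaussian testing problem (see context), with minimax risk $\gamma$. (i) If $\mu_m=\mu\ge\sqrt{2\log2}$ for all $m$, there is a sequence of tests $(T_m)$ with $\gamma(T_m)\to0$. (ii) If $\mu_m=\mu<\sqrt{2\log 2}$ (constant, $\mu>0$), there is no sequence of tests with $\gamma(T_m)\to0$. (iii) If $\mu_m\to0$, then every sequence of tests satisfies $\liminf_{m}\gamma(T_m)\ge1$.
   Context: Binary tree: $V_m=\{(i,j):0\le i\le m-1,\ 0\le j<2^i\}$, with oriented edges $(i,j)\to(i+1,2j+s)$, $s\in\{0,1\}$; the origin (root) is $(0,0)$. $\mathcal{P}_m$ is the set of the $2^{m-1}$ directed paths from the root visiting $m$ vertices (one in each level $0,\dots,m-1$). Under $H_0$ (law $\mathbf{P}_0$) the $X_v$, $v\in V_m$, are i.i.d. $N(0,1)$; under $H_{1,m}$ with unknown path $p\in\mathcal{P}_m$ (law $\mathbf{P}_{1,p}$) they are independent with $X_v\sim N(\mu_m,1)$ on $p$ and $N(0,1)$ off $p$, $\mu_m>0$. A test $T_m$ is a measurable $\{0,1\}$-valued function of $(X_v)$, with minimax risk $\gamma(T_m)=\mathbf{P}_0(T_m=1)+\sup_{p\in\mathcal{P}_m}\mathbf{P}_{1,p}(T_m=0)$. *)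

(* Defs.v *)
From HB Require Import structures.
From mathcomp Require Import all_boot all_order all_algebra.
From mathcomp Require Import all_classical all_reals all_analysis.
Set Implicit Arguments. Unset Strict Implicit. Unset Printing Implicit Defensive.
Import Order.TTheory GRing.Theory Num.Theory.
Import numFieldNormedType.Exports.
Local Open Scope classical_set_scope.
Local Open Scope ring_scope.

Definition vert (m : nat) : finType := {i : 'I_m & 'I_(2 ^ i)}.
Definition level {m} (v : vert m) : nat := val (tag v).
Definition pos {m} (v : vert m) : nat := val (tagged v).

Definition edge {m} (u w : vert m) : bool :=
  (level w == (level u).+1) && ((pos w == (pos u).*2) || (pos w == (pos u).*2.+1)).

Definition is_tree_path (m : nat) (s : seq (vert m)) : Prop :=
  exists v0 rest, [/\ s = v0 :: rest, level v0 = 0%N, pos v0 = 0%N,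
                      path edge v0 rest & size s = m].

Arguments is_tree_path : clear implicits.

Definition coord_sigma {R : realType} (V : finType) : set (set (V -> R)) :=
  <<s \bigcup_(v in [set: V]) preimage_set_system setT (fun x : V -> R => x v) measurable >>.

Definition is_test {R : realType} (V : finType) (T : (V -> R) -> bool) : Prop :=
  coord_sigma [set x | T x].

(** Law of independent X_v ~ N(mu v, 1), v in V, given through iterated
    (Tonelli) integration of nonnegative functions over the coordinates. *)
Definition upd {R : realType} (V : finType) (x : V -> R) (v : V) (y : R) : V -> R :=
  fun w => if w == v then y else x w.

Fixpoint iter_gauss {R : realType} (V : finType) (mu : V -> R) (s : seq V)
  (f : (V -> R) -> \bar R) (x : V -> R) : \bar R :=
  match s with
  | [::] => f x
  | v :: s' => (\int[normal_prob (mu v) 1]_y iter_gauss mu s' f (upd x v y))%E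
  end.

Definition gauss_prob {R : realType} (V : finType) (mu : V -> R) (A : set (V -> R)) : \bar R :=
  iter_gauss mu (enum V) (fun x => (\1_A x)%:E) (fun _ => 0).

Definition mean0 {R : realType} m : vert m -> R := fun _ => 0.
Definition mean_path {R : realType} m (mu : R) (p : seq (vert m)) : vert m -> R :=
  fun v => if v \in p then mu else 0.

Definition risk {R : realType} (m : nat) (mu : R) (T : (vert m -> R) -> bool) : \bar R :=
  (gauss_prob (@mean0 R m) [set x | T x] +
   ereal_sup [set gauss_prob (mean_path mu p) [set x | ~~ T x] | p in is_tree_path m])%E.

(* Main.v *)
(**
Only two computations with Gaussians are needed: exponentials of linear forms
have explicit expectations, and functions of disjoint sets of coordinates are
independent.  Write [c = sqrt (2 ln 2)], so that [exp (c^2 / 2) = 2].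

(i) Cut the levels into [N] blocks, the one starting at level [l] having length
[2 (l + K)^2], and reject when some descending path through a block starting at
level [l] has [sum (X - c) >= c (l + K) / 2].  Under the null hypothesis a union
bound with the exponential moment of order [c] costs [2^-K] per block.  Under
the alternative the centred block sum of the true path has standard deviation
comparable with the threshold, so each block fails with probability at most
63/64 by the Paley-Zygmund inequality, and the blocks are independent.  This
also covers the critical case [mu = c].

(ii) The sup over paths dominates the average, so the likelihood ratio [L] of
the uniform mixture governs the risk.  Its second moment blows up for
[mu^2 >= ln 2]; it is bounded up to [mu^2 < 2 ln 2] after truncating each path
likelihood to the event that no initial partial sum exceeds its mean by much.
The truncated [L] keeps expectation at least 1/2, so it cannot concentrate on
rejection regions of small null probability.

(iii) With [r = exp (mu^2) < 2], [E L^2 <= r / (2 - r)], which tends to 1, and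
the risk is at least [1 - E |L - 1|].
*)

Require Import Defs.
From HB Require Import structures.
From mathcomp Require Import all_boot all_order all_algebra.
From mathcomp Require Import all_classical all_reals all_analysis measurable_realfun.
From mathcomp Require Import ring lra.
Import Order.TTheory GRing.Theory Num.Theory.
Import numFieldNormedType.Exports.
Local Open Scope classical_set_scope.
Local Open Scope ring_scope.
Set Implicit Arguments. Unset Strict Implicit. Unset Printing Implicit Defensive.

(** * Gaussian integrals on the line *)

Section density.
Context d (T : measurableType d) (R : realType).
Local Open Scope ereal_scope.
Variables (nu mu : {measure set T -> \bar R}) (g : T -> R).
Hypothesis g_ge0 : forall x, (0 <= g x)%R.
Hypothesis mg_ : measurable_fun setT g.
Hypothesis nuE : forall A, measurable A -> nu A = \int[mu]_(x in A) (g x)%:E.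
Import HBNNSimple.

(** The hypothesis [nuE] is the case of indicators; linearity extends it to simple functions, and
    monotone convergence along [nnsfun_approx] does the rest. *)
Lemma ge0_integral_density (f : T -> \bar R) :
    measurable_fun setT f -> (forall x, 0 <= f x) ->
  \int[nu]_x f x = \int[mu]_x (f x * (g x)%:E).
Proof.
move=> mf f0.
have g0 x : 0 <= (g x)%:E by rewrite lee_fin.
have mg : measurable_fun setT (EFin \o g) by apply/measurable_EFinP.
pose h := nnsfun_approx measurableT mf.
have hf x : (h n x)%:E @[n --> \oo] --> f x by exact: cvg_nnsfun_approx.
have ndh x : nondecreasing_seq (fun n => (h n x)%:E).
  by move=> a b ab; rewrite lee_fin; exact/lefP/nd_nnsfun_approx.
have h0 n x : 0 <= (h n x)%:E by rewrite lee_fin.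
have mh n : measurable_fun setT (fun x => (h n x)%:E).
  by apply/measurable_EFinP.
transitivity (limn (fun n => \int[nu]_x (h n x)%:E)).
  rewrite -monotone_convergence//.
  by apply: eq_integral => x _; exact/esym/cvg_lim.
transitivity (limn (fun n => \int[mu]_x ((h n x)%:E * (g x)%:E))); last first.
  rewrite -monotone_convergence//.
  - apply: eq_integral => x _; apply/cvg_lim => //.
    by apply: cvgeZr => //; exact: hf.
  - by move=> n; apply: emeasurable_funM; [exact: mh|exact: mg].
  - by move=> n x _; rewrite mule_ge0.
  - by move=> x _ a b ab; rewrite lee_wpmul2r//; exact: ndh.
congr (limn _); apply/funext => n.
have indE y : measurable_fun setT (fun x => (y * \1_(h n @^-1` [set y]) x)%:E).
  by apply/measurable_EFinP; exact: measurable_funM.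
under eq_integral => x _ do rewrite fimfunE -fsumEFin//.
rewrite ge0_integral_fsum//; last by move=> y x _; exact: nnfun_muleindic_ge0.
under [RHS]eq_integral => x _.
  rewrite fimfunE -fsumEFin// ge0_mule_fsuml; last first.
    by move=> y; exact: nnfun_muleindic_ge0.
  over.
rewrite ge0_integral_fsum//; last 2 first.
  - by move=> y; apply: emeasurable_funM; [exact: indE|exact: mg].
  - by move=> y x _; rewrite mule_ge0//; exact: nnfun_muleindic_ge0.
apply: eq_fsbigr => y /[!inE] -[t _ <-] {y}.
rewrite integralZl_indic_nnsfun//.
under [RHS]eq_integral do rewrite EFinM -muleA.
rewrite ge0_integralZl//.
- rewrite integral_indic// setIT nuE// integral_mkcond.
  congr (_ * _); apply: eq_integral => x _; rewrite /restrict indicE.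
  by case: ifP => _ /=; rewrite ?mul1e ?mul0e.
- by apply: emeasurable_funM => //; exact/measurable_EFinP.
- by move=> x _; rewrite mule_ge0// lee_fin.
- exact: h0.
Qed.
End density.

Section gaussian_density.
Context {R : realType}.
Local Open Scope ereal_scope.
Notation leb := (@lebesgue_measure R).
Lemma ge0_integral_normal_prob (m s : R) (f : R -> \bar R) :
    measurable_fun setT f -> (forall x, 0 <= f x) ->
  \int[normal_prob m s]_x f x = \int[leb]_x (f x * (normal_pdf m s x)%:E).
Proof.
exact: (@ge0_integral_density _ (measurableTypeR R) R (normal_prob m s) leb _
  (normal_pdf_ge0 m s) (measurable_normal_pdf m s)).
Qed.

Lemma integral_normal_cst (m s : R) (c : \bar R) :
  \int[normal_prob m s]_x c = c.
Proof.
rewrite integral_cst// -[RHS]mule1; congr (_ * _).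
exact: (probability_setT (normal_prob m s)).
Qed.

Lemma measurable_expR_affine (b c : R) :
  measurable_fun setT (fun x : R => expR (b * x - c)).
Proof.
apply: measurableT_comp => //; apply: measurable_funB => //.

Qed.

Lemma normal_pdf_shift (m x : R) :
  normal_pdf m 1 x = (expR (m * x - m ^+ 2 / 2) * normal_pdf 0 1 x)%R.
Proof.
rewrite !normal_pdfE ?oner_neq0// mulrCA; congr (_ * _)%R.
rewrite /normal_fun -expRD; congr (expR _).
by rewrite expr1n; field.
Qed.

(** The Cameron-Martin formula in dimension one, obtained by comparing the two densities with
    respect to Lebesgue measure. *)
Lemma ge0_integral_normal_shift (m : R) (f : R -> \bar R) :
    measurable_fun setT f -> (forall x, 0 <= f x) ->
  \int[normal_prob m 1]_x f x =
  \int[normal_prob 0 1]_x ((expR (m * x - m ^+ 2 / 2))%:E * f x).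
Proof.
move=> mf f0; rewrite !ge0_integral_normal_prob//.
- apply: eq_integral => x _.
  by rewrite normal_pdf_shift EFinM muleA (muleC (f x)).
- apply: emeasurable_funM => //; apply/measurable_EFinP.
  exact: measurable_expR_affine.
- by move=> x; rewrite mule_ge0// lee_fin expR_ge0.
Qed.

Lemma integral_normal_expR (m a : R) :
  \int[normal_prob m 1]_x (expR (a * x))%:E =
  (expR (a * m + a ^+ 2 / 2))%:E.
Proof.
have mexp b c : measurable_fun setT (fun x : R => (expR (b * x - c))%:E).
  by apply/measurable_EFinP; exact: measurable_expR_affine.
have e0 b c (x : R) : 0 <= (expR (b * x - c))%:E by rewrite lee_fin expR_ge0.
under eq_integral do rewrite -[(a * _)%R]subr0.
rewrite (ge0_integral_normal_shift _ (mexp a 0%R) (e0 a 0%R)).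
(* Completing the square exhibits the integrand as a constant times the density of N(a + m, 1)
   relative to N(0, 1), whose integral is 1. *)
transitivity (\int[normal_prob 0 1]_x
  ((expR (a * m + a ^+ 2 / 2))%:E * (expR ((a + m) * x - (a + m) ^+ 2 / 2))%:E)).
  apply: eq_integral => x _; rewrite -!EFinM -!expRD; congr (expR _)%:E.
  by field.
rewrite ge0_integralZl//; last exact: mexp.
rewrite -[RHS]mule1; congr (_ * _).
have : \int[normal_prob (a + m) 1]_x (cst 1 : R -> \bar R) x = 1.
  exact: integral_normal_cst.
rewrite (@ge0_integral_normal_shift _ (cst 1)) => [h||//]; last exact: measurable_cst.
by rewrite -h; apply: eq_integral => x _; rewrite mule1.
Qed.

End gaussian_density.

(** * Iterated Gaussian integrals *)

Section iterated_gaussian.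
Context {R : realType} {V : finType}.
Implicit Types (mu : V -> R) (s : seq V).

(** Bundling the sigma-algebra [coord_sigma] with [V -> R] lets the general theory of measurable
    functions apply to tests. *)
Definition coordT : measurableType _ := g_sigma_algebraType
  (\bigcup_(v in [set: V])
     preimage_set_system setT (fun x : V -> R => x v) measurable).

Lemma measurable_coord (v : V) : measurable_fun setT (fun x : coordT => x v : R).
Proof.
move=> _ B mB; apply: sub_sigma_algebra; exists v => //; exists B => //.
Qed.

(** Tonelli needs joint measurability in the point and the new value; the preimage of a generating
    cylinder is a rectangle. *)
Lemma measurable_upd (v : V) :
  measurable_fun setT (fun p : coordT * R => upd p.1 v p.2 : coordT).
Proof.
apply: measurability; first by [].
move=> _ [_ [w _ [B mB <-]] <-]; rewrite !setTI.
rewrite (_ : _ @^-1` _ =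
    if w == v then setT `*` B else ((fun x : coordT => x w) @^-1` B) `*` setT).
  case: ifPn => _; apply: measurableX => //.
  by rewrite -[X in measurable X]setTI; exact: measurable_coord.
by apply/seteqP; split => p /=; rewrite /upd; case: eqP => _ // [].
Qed.

Lemma updC (x : V -> R) (v w : V) (y z : R) : v != w ->
  upd (upd x v y) w z = upd (upd x w z) v y.
Proof.
move=> vw; apply/funext => u; rewrite /upd; case: eqVneq => [->|//].
by rewrite eq_sym (negbTE vw).
Qed.

Local Open Scope ereal_scope.

Lemma iter_gauss_ge0 mu s (f : coordT -> \bar R) x :
  (forall x, 0 <= f x) -> 0 <= iter_gauss mu s f x.
Proof.
by move=> f0; elim: s x => //= v s IH x; apply: integral_ge0 => y _; exact: IH.
Qed.

Lemma measurable_upd1 (x : coordT) (v : V) (f : coordT -> \bar R) :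
  measurable_fun setT f -> measurable_fun setT (fun y : R => f (upd x v y)).
Proof.
move=> mf; apply: (measurableT_comp mf).
exact: (measurableT_comp (measurable_upd v) (measurable_pair1 x)).
Qed.

Lemma measurable_iter_gauss mu s (f : coordT -> \bar R) :
    measurable_fun setT f -> (forall x, 0 <= f x) ->
  measurable_fun setT (iter_gauss mu s f : coordT -> \bar R).
Proof.
move=> mf f0; elim: s => //= v s IH.
apply: (@measurable_fun_fubini_tonelli_F _ _ _ _ _ (normal_prob (mu v) 1)
  (fun p : coordT * R => iter_gauss mu s f (upd p.1 v p.2))).
- exact: (measurableT_comp IH (measurable_upd v)).
- by move=> p; exact: iter_gauss_ge0.
Qed.

Lemma eq_iter_gauss mu s (f g : coordT -> \bar R) x :
  f =1 g -> iter_gauss mu s f x = iter_gauss mu s g x.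
Proof. by move=> /funext ->. Qed.

Lemma iter_gauss_le mu s (f g : coordT -> \bar R) x :
    measurable_fun setT f -> measurable_fun setT g ->
    (forall x, 0 <= f x) -> (forall x, f x <= g x) ->
  iter_gauss mu s f x <= iter_gauss mu s g x.
Proof.
move=> mf mg f0 fg; have g0 y : 0 <= g y by exact: le_trans (fg y).
elim: s x => //= v s IH x; apply: ge0_le_integral => //.
- by move=> y _; exact: iter_gauss_ge0.
- by apply: measurable_upd1; exact: measurable_iter_gauss.
- by apply: measurable_upd1; exact: measurable_iter_gauss.
Qed.

Lemma iter_gaussD mu s (f g : coordT -> \bar R) x :
    measurable_fun setT f -> measurable_fun setT g ->
    (forall x, 0 <= f x) -> (forall x, 0 <= g x) ->
  iter_gauss mu s (fun x => f x + g x) x =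
  iter_gauss mu s f x + iter_gauss mu s g x.
Proof.
move=> mf mg f0 g0; elim: s x => //= v s IH x.
rewrite -ge0_integralD//.
- by apply: eq_integral => y _; exact: IH.
- by move=> y _; exact: iter_gauss_ge0.
- by apply: measurable_upd1; exact: measurable_iter_gauss.
- by move=> y _; exact: iter_gauss_ge0.
- by apply: measurable_upd1; exact: measurable_iter_gauss.
Qed.

Definition free_of (v : V) (T : Type) (F : (V -> R) -> T) :=
  forall x y, F (upd x v y) = F x.

Lemma iter_gaussMl mu s (F : coordT -> R) (f : coordT -> \bar R) x :
    {in s, forall v, free_of v F} -> (forall x, (0 <= F x)%R) ->
    measurable_fun setT f -> (forall x, 0 <= f x) ->
  iter_gauss mu s (fun x => (F x)%:E * f x) x = (F x)%:E * iter_gauss mu s f x.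
Proof.
move=> Fs F0 mf f0; elim: s Fs x => //= v s IH Fs x.
have Fv : free_of v F by apply: Fs; rewrite mem_head.
have Fs' : {in s, forall v, free_of v F}.
  by move=> w ws; apply: Fs; rewrite inE ws orbT.
under eq_integral do rewrite IH// Fv.
rewrite ge0_integralZl//.
- by apply: measurable_upd1; exact: measurable_iter_gauss.
- by move=> y _; exact: iter_gauss_ge0.
- by rewrite lee_fin.
Qed.

Lemma iter_gauss_cst mu s (r : R) x : (0 <= r)%R ->
  iter_gauss mu s (fun=> r%:E) x = r%:E.
Proof.
move=> r0; elim: s x => //= v s IH x.
under eq_integral do rewrite IH.
exact: integral_normal_cst.
Qed.

(** When the integration runs over [v] itself, the updated value is overwritten; over another
    coordinate, the two updates commute. *)
Lemma free_iter_gauss mu s v (f : coordT -> \bar R) :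
  free_of v f -> free_of v (iter_gauss mu s f).
Proof.
move=> fv; elim: s => //= w s IH x y; apply: eq_integral => z _.
have [->|vw] := eqVneq v w; last by rewrite updC// IH.
by congr (iter_gauss _ _ _ _); apply/funext => u; rewrite /upd; case: eqP.
Qed.

(** Independence of functions of disjoint sets of coordinates: at each integration one of the two
    factors is constant in the current coordinate and leaves the integral. *)
Lemma iter_gauss_indep mu s (F G : coordT -> R) x :
    measurable_fun setT F -> measurable_fun setT G ->
    (forall x, (0 <= F x)%R) -> (forall x, (0 <= G x)%R) ->
    (forall v, free_of v F \/ free_of v G) ->
  iter_gauss mu s (fun x => (F x * G x)%:E) x =
  iter_gauss mu s (EFin \o F) x * iter_gauss mu s (EFin \o G) x.
Proof.
move=> mF mG F0 G0 FG.
have mEF : measurable_fun setT (EFin \o F) by exact/measurable_EFinP.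
have mEG : measurable_fun setT (EFin \o G) by exact/measurable_EFinP.
have EF0 y : 0 <= (EFin \o F) y by rewrite /= lee_fin.
have EG0 y : 0 <= (EFin \o G) y by rewrite /= lee_fin.
elim: s x => //= v s IH x.
under eq_integral do rewrite IH.
have aux (f g : coordT -> \bar R) : measurable_fun setT f ->
    measurable_fun setT g -> (forall x, 0 <= f x) -> (forall x, 0 <= g x) ->
    free_of v f ->
    \int[normal_prob (mu v) 1]_y
      (iter_gauss mu s f (upd x v y) * iter_gauss mu s g (upd x v y)) =
    \int[normal_prob (mu v) 1]_y (iter_gauss mu s f (upd x v y)) *
    \int[normal_prob (mu v) 1]_y (iter_gauss mu s g (upd x v y)).
  move=> mf mg f0 g0 fv; under eq_integral do rewrite free_iter_gauss//.
  under [X in _ = X * _]eq_integral do rewrite free_iter_gauss//.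
  rewrite ge0_integralZl//.
  - by rewrite integral_normal_cst.
  - by apply: measurable_upd1; exact: measurable_iter_gauss.
  - by move=> y _; exact: iter_gauss_ge0.
  - exact: iter_gauss_ge0.
have [Fv|Gv] := FG v; first by apply: aux => // y z; rewrite /= Fv.
under eq_integral do rewrite muleC.
by rewrite aux 1?muleC// => y z; rewrite /= Gv.
Qed.

End iterated_gaussian.

(** * Expectations under Gaussian product laws and change of measure *)

Section gaussian_expectation.
Context {R : realType} {V : finType}.
Implicit Types (mu a : V -> R) (s : seq V) (f g : (V -> R) -> R).
Local Notation mfun f := (measurable_fun setT (f : @coordT R V -> R)).
Local Open Scope ereal_scope.

Lemma measurable_coord_sum s (a b : V -> R) :
  mfun (fun x => \sum_(v <- s) (a v * x v - b v))%R.
Proof.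
apply: measurable_sum => v; apply: measurable_funB => //.
by apply: measurable_funM => //; exact: measurable_coord.
Qed.

Lemma measurable_expR_coord_sum s (a b : V -> R) :
  mfun (fun x => expR (\sum_(v <- s) (a v * x v - b v)))%R.
Proof. by apply: measurableT_comp => //; exact: measurable_coord_sum. Qed.

(** The one-dimensional shift is applied coordinate by coordinate. As [s] has no repetition, the
    density factor of [v] is constant for the inner integrals and can be moved inside them. *)
Lemma iter_gauss_shift mu s f (x : V -> R) : uniq s ->
    mfun f -> (forall x, (0 <= f x)%R) ->
  iter_gauss mu s (EFin \o f) x = iter_gauss (fun=> 0%R) s (fun x =>
    (f x * expR (\sum_(v <- s) (mu v * x v - mu v ^+ 2 / 2)))%:E) x.
Proof.
move=> + mf f0; elim: s x => [x _|v s IH x /= /andP[vs us]].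
  by rewrite /= big_nil expR0 mulr1.
pose F (x : V -> R) := expR (mu v * x v - mu v ^+ 2 / 2).
pose G (x : V -> R) := (f x * expR (\sum_(v <- s) (mu v * x v - mu v ^+ 2 / 2)))%R.
have G0 y : 0 <= (EFin \o G) y by rewrite lee_fin mulr_ge0 ?expR_ge0.
have mG : measurable_fun setT (EFin \o G : coordT -> _).
  apply/measurable_EFinP; apply: measurable_funM => //.
  exact: measurable_expR_coord_sum.
under eq_integral do rewrite IH//.
rewrite ge0_integral_normal_shift.
- apply: eq_integral => y _.
  transitivity (iter_gauss (fun=> 0%R) s
      (fun x => (F x)%:E * (EFin \o G) x) (upd x v y)).
    rewrite iter_gaussMl//.
    + by rewrite /F /upd eqxx.
    + move=> w ws z t; rewrite /F /upd; case: eqP => // vw.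
      by rewrite vw ws in vs.
    + by move=> z; exact: expR_ge0.
  apply: eq_iter_gauss => z; rewrite /= /F /G big_cons -EFinM mulrCA.
  by rewrite [in RHS]expRD.
- by apply: measurable_upd1; exact: measurable_iter_gauss.
- by move=> y; exact: iter_gauss_ge0.
Qed.

Lemma iter_gauss_expR mu a s (x : V -> R) : uniq s ->
  iter_gauss mu s (fun x => (expR (\sum_(v <- s) a v * x v))%:E) x =
  (expR (\sum_(v <- s) (a v * mu v + a v ^+ 2 / 2)))%:E.
Proof.
elim: s x => [x _|v s IH x /= /andP[vs us]].
  by rewrite /= !big_nil.
pose F (x : V -> R) := expR (a v * x v).
pose G (x : V -> R) := (expR (\sum_(v <- s) a v * x v))%R.
have G0 y : 0 <= (EFin \o G) y by rewrite lee_fin expR_ge0.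
have mG : measurable_fun setT (EFin \o G : coordT -> _).
  apply/measurable_EFinP; have := measurable_expR_coord_sum s a (fun=> 0%R).
  by apply: eq_measurable_fun => y _ /=; under eq_bigr do rewrite subr0.
transitivity (\int[normal_prob (mu v) 1]_y ((expR (a v * y))%:E *
   (expR (\sum_(v <- s) (a v * mu v + a v ^+ 2 / 2)))%:E)).
  apply: eq_integral => y _.
  transitivity (iter_gauss mu s
      (fun x => (F x)%:E * (EFin \o G) x) (upd x v y)).
    apply: eq_iter_gauss => z.
    by rewrite /= /F /G big_cons expRD -EFinM.
  rewrite iter_gaussMl//.
  + by rewrite IH// /F /upd eqxx.
  + move=> w ws z t; rewrite /F /upd; case: eqP => // vw.
    by rewrite vw ws in vs.
  + by move=> z; exact: expR_ge0.
rewrite ge0_integralZr//.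
- by rewrite integral_normal_expR -EFinM -expRD big_cons.
- have := measurable_expR_affine (a v) (0 : R).
  move=> /measurable_EFinP; apply: eq_measurable_fun => y _ /=.
  by rewrite subr0.
Qed.

(** Every coordinate occurs in [enum V], so the base point 0 is entirely overwritten before [f] is
    evaluated. *)
Definition Egauss mu f := iter_gauss mu (enum V) (EFin \o f) (fun=> 0%R).

Lemma gauss_probE mu (A : set (V -> R)) : gauss_prob mu A = Egauss mu (\1_A).
Proof. by []. Qed.

Lemma Egauss_ge0 mu f : (forall x, (0 <= f x)%R) -> 0 <= Egauss mu f.
Proof. by move=> f0; apply: iter_gauss_ge0 => x; rewrite lee_fin. Qed.

Lemma eq_Egauss mu f g : f =1 g -> Egauss mu f = Egauss mu g.
Proof. by move=> /funext ->. Qed.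

Lemma Egauss_le mu f g : mfun f -> mfun g -> (forall x, (0 <= f x)%R) ->
  (forall x, (f x <= g x)%R) -> Egauss mu f <= Egauss mu g.
Proof.
move=> mf mg f0 fg; apply: iter_gauss_le => //; try exact/measurable_EFinP.
Qed.

Lemma EgaussD mu f g : mfun f -> mfun g ->
    (forall x, (0 <= f x)%R) -> (forall x, (0 <= g x)%R) ->
  Egauss mu (fun x => f x + g x)%R = Egauss mu f + Egauss mu g.
Proof.
move=> mf mg f0 g0; rewrite /Egauss -iter_gaussD//.
- exact/measurable_EFinP.
- exact/measurable_EFinP.
Qed.

Lemma Egauss_cst mu (r : R) : (0 <= r)%R -> Egauss mu (fun=> r) = r%:E.
Proof. exact: iter_gauss_cst. Qed.

Lemma EgaussZ mu f (r : R) : mfun f -> (forall x, (0 <= f x)%R) -> (0 <= r)%R ->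
  Egauss mu (fun x => r * f x)%R = r%:E * Egauss mu f.
Proof.
move=> mf f0 r0; rewrite /Egauss -(@iter_gaussMl _ _ _ _ (fun=> r))//.
exact/measurable_EFinP.
Qed.

Lemma Egauss_sum (I : Type) mu (r : seq I) (f : I -> (V -> R) -> R) :
    (forall i, mfun (f i)) -> (forall i x, (0 <= f i x)%R) ->
  Egauss mu (fun x => \sum_(i <- r) f i x)%R = \sum_(i <- r) Egauss mu (f i).
Proof.
move=> mf f0; elim: r => [|i r IH].
  by under eq_Egauss do rewrite big_nil; rewrite big_nil Egauss_cst.
under eq_Egauss do rewrite big_cons; rewrite big_cons EgaussD//.
- by rewrite IH.
- exact: measurable_sum.
- by move=> x; exact: sumr_ge0.
Qed.

Lemma Egauss_indep mu f g : mfun f -> mfun g ->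
    (forall x, (0 <= f x)%R) -> (forall x, (0 <= g x)%R) ->
    (forall v, free_of v f \/ free_of v g) ->
  Egauss mu (fun x => f x * g x)%R = Egauss mu f * Egauss mu g.
Proof. exact: iter_gauss_indep. Qed.

(** The likelihood ratio of the product law with means [mu] against the centred one; see
    [Egauss_lik]. *)
Definition lik mu (x : V -> R) := expR (\sum_v (mu v * x v - mu v ^+ 2 / 2)).

Lemma measurable_lik mu : mfun (lik mu).
Proof. exact: measurable_expR_coord_sum. Qed.

Lemma lik_ge0 mu x : (0 <= lik mu x)%R. Proof. exact: expR_ge0. Qed.

Lemma Egauss_lik mu f : mfun f -> (forall x, (0 <= f x)%R) ->
  Egauss mu f = Egauss (fun=> 0%R) (fun x => f x * lik mu x)%R.
Proof.
move=> mf f0; rewrite /Egauss iter_gauss_shift ?enum_uniq//.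
by apply: eq_iter_gauss => x /=; rewrite /lik big_enum.
Qed.

Lemma Egauss_expR mu a :
  Egauss mu (fun x => expR (\sum_v a v * x v)) =
  (expR (\sum_v (a v * mu v + a v ^+ 2 / 2)))%:E.
Proof.
rewrite /Egauss -[in RHS]big_enum -(@iter_gauss_expR _ _ _ (fun=> 0%R)) ?enum_uniq//.
by apply: eq_iter_gauss => x /=; rewrite big_enum.
Qed.

End gaussian_expectation.

(** * Paths of the binary tree *)

Section tree_paths.
Context {m : nat}.

(** Reduction modulo [2 ^ i] makes the function total; it changes nothing for the ancestors of a
    genuine leaf, by [pos_anc]. *)
Definition node (i : 'I_m) (k : nat) : vert m :=
  Tagged (fun i : 'I_m => 'I_(2 ^ i))
    (Ordinal (ltn_pmod k (expn_gt0 2 i : 0 < 2 ^ i)%N)).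

(* The ancestor at level [i] of the leaf [q]. *)
Definition anc (q : nat) (i : 'I_m) : vert m := node i (q %/ 2 ^ (m.-1 - i)).

Definition path_of (q : nat) : seq (vert m) := [seq anc q i | i <- enum 'I_m].

Definition on_path (q : nat) (v : vert m) : bool := v == anc q (tag v).

Lemma vert_eq (u w : vert m) : level u = level w -> pos u = pos w -> u = w.
Proof.
case: u w => [i k] [j l]; rewrite /level /pos /= => /val_inj ij.
by case: _ / ij l => l /val_inj ->.
Qed.

Lemma tag_anc q i : tag (anc q i) = i. Proof. by []. Qed.

Lemma level_anc q i : level (anc q i) = i. Proof. by []. Qed.

Lemma pos_anc q i : (q < 2 ^ m.-1)%N -> pos (anc q i) = (q %/ 2 ^ (m.-1 - i))%N.
Proof.
move=> qm; rewrite /pos /= modn_small// ltn_divLR ?expn_gt0//.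
by rewrite -expnD subnKC// -ltnS (ltn_predK (ltn_ord i)).
Qed.

Lemma mem_path_of q v : (v \in path_of q) = on_path q v.
Proof.
apply/mapP/eqP => [[i _ ->]//|vq]; exists (tag v) => //.
by rewrite mem_enum.
Qed.

End tree_paths.

Lemma divn_exp_half (q e : nat) : (q %/ 2 ^ e.+1 = (q %/ 2 ^ e)./2)%N.
Proof. by rewrite expnSr divnMA divn2. Qed.

Lemma edge_anc n q (i j : 'I_n.+1) : (q < 2 ^ n)%N -> j = i.+1 :> nat ->
  edge (anc q i) (anc q j).
Proof.
move=> qn ji; rewrite /edge !level_anc ji eqxx /= !pos_anc// ji.
have -> : (n.+1.-1 - i = (n.+1.-1 - i.+1).+1)%N.
  by rewrite subnSK //= -ltnS -ji ltn_ord.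
rewrite divn_exp_half; set k := (q %/ _)%N.
have := odd_double_half k.
by case: (odd k); rewrite /= ?add0n ?add1n => ->; rewrite eqxx ?orbT.
Qed.

Lemma is_tree_path_of n q : (q < 2 ^ n)%N -> is_tree_path n.+1 (path_of q).
Proof.
move=> qn; exists (anc q ord0), [seq anc q (lift ord0 i) | i <- enum 'I_n]; split.
- by rewrite /path_of enum_ordSl /= -map_comp.
- by [].
- by rewrite pos_anc// subn0 divn_small.
- apply/(pathP (anc q ord0)) => i; rewrite size_map size_enum_ord => iN.
  rewrite (nth_map (Ordinal iN)) ?size_enum_ord//.
  case: i iN => [|i] iN /=.
    by apply: edge_anc => //=; rewrite nth_enum_ord.
  have iN' : (i < n)%N by exact: ltnW.
  rewrite (nth_map (Ordinal iN)) ?size_enum_ord//; apply: edge_anc => //=.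
  by rewrite /bump /= !nth_enum_ord.
- by rewrite /= size_map size_enum_ord.
Qed.

(** Halving a position leads to the parent, so the whole path is recovered from the position of its
    last vertex, which is the witness [q]. *)
Lemma tree_path_ofP n (p : seq (vert n.+1)) : is_tree_path n.+1 p ->
  exists2 q, (q < 2 ^ n)%N & p = path_of q.
Proof.
move=> [v0 [rest [-> lv0 pv0 /(pathP v0) e /= [sz]]]].
pose f i := nth v0 (v0 :: rest) i.
have lev i : (i <= n)%N -> level (f i) = i.
  elim: i => // i IH iN; have := e i; rewrite sz => /(_ iN) /andP[/eqP].
  by rewrite -/(f i) => + _; rewrite IH 1?ltnW.
have par i : (i < n)%N -> pos (f i) = (pos (f i.+1))./2.
  move=> iN; have := e i; rewrite sz => /(_ iN) /andP[_ /orP[]/eqP].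
    by rewrite -/(f i) /f /= => ->; rewrite doubleK.
  by rewrite -/(f i) /f /= => ->; rewrite -[RHS]/(uphalf (_.*2)) uphalf_double.
have an k : (k <= n)%N -> pos (f (n - k)%N) = (pos (f n) %/ 2 ^ k)%N.
  elim: k => [|k IH] kN; first by rewrite subn0 divn1.
  rewrite divn_exp_half -IH 1?ltnW// par ?subnSK//.
  exact: leq_subr.
have qn : (pos (f n) < 2 ^ n)%N.
  have := ltn_ord (tagged (f n)); rewrite -/(pos _).
  by have := lev n (leqnn n); rewrite /level /= => ->.
exists (pos (f n)) => //.
apply: (@eq_from_nth _ v0); first by rewrite /= size_map size_enum_ord sz.
move=> i; rewrite /= sz => iN.
rewrite [RHS](nth_map (Ordinal iN)) ?size_enum_ord//.
apply: vert_eq; rewrite -/(f i).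
  by rewrite lev// level_anc nth_enum_ord.
rewrite pos_anc// nth_enum_ord// -an ?leq_subr//.
by rewrite subKn.
Qed.

(** A path meets each level exactly once, so its vertices can be indexed by their levels. *)
Lemma big_on_path (R : realType) m (f : vert m -> R) (B : pred 'I_m) q :
  \sum_(v | B (tag v) && on_path q v) f v = \sum_(i | B i) f (anc q i).
Proof.
rewrite (reindex_onto (anc q) (@tag _ _)) /=; last by move=> v /andP[_ /eqP].
by apply: eq_bigl => i; rewrite /on_path tag_anc !eqxx !andbT.
Qed.

(** An initial segment of the integers is determined by its cardinality. *)
Lemma down_closed_count n (b : nat -> bool) i :
  (forall i j, (i <= j)%N -> b j -> b i) -> (i < n)%N ->
  b i = (i < \sum_(k < n) b k)%N.
Proof.
move=> bd; elim: n => // n IH; rewrite ltnS big_ord_recr /=.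
have le_n : (\sum_(k < n) b k <= n)%N.
  rewrite -[X in (_ <= X)%N](card_ord n) -sum1_card.
  by apply: leq_sum => k _; case: (b k).
case bn : (b n) => /= [|] ni.
  have -> : (\sum_(k < n) b k = n)%N.
    rewrite -[RHS](card_ord n) -sum1_card; apply: eq_bigr => k _.
    by rewrite (bd _ n)// ltnW.
  by rewrite addn1 ltnS ni (bd _ n).
rewrite addn0; move: ni; rewrite leq_eqVlt => /predU1P[->|]; last exact: IH.
by rewrite bn ltnNge le_n.
Qed.

(** * Common initial segments of two paths *)

Section meet.
Variable n : nat.
Implicit Types p q : 'I_(2 ^ n).

Definition meet p q : nat := (\sum_(i < n.+1) (anc p i == anc q i))%N.

Lemma anc_eqE p q (i : 'I_n.+1) :
  (anc p i == anc q i) = (p %/ 2 ^ (n - i) == q %/ 2 ^ (n - i))%N.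
Proof.
apply/eqP/eqP => [/(congr1 pos)|pq]; first by rewrite !pos_anc.
by apply: vert_eq => //; rewrite !pos_anc.
Qed.

(** Agreement at one level forces agreement at all shallower ones, so the shared vertices form an
    initial segment, of length [meet p q]. *)
Lemma anc_eq_meet p q (i : 'I_n.+1) : (anc p i == anc q i) = (i < meet p q)%N.
Proof.
rewrite /meet; under eq_bigr do rewrite anc_eqE.
pose b i := (p %/ 2 ^ (n - i) == q %/ 2 ^ (n - i))%N.
rewrite anc_eqE; apply: (@down_closed_count n.+1 b) => // {}i j ij.
rewrite /b; have -> : (n - i = (n - j) + ((n - i) - (n - j)))%N.
  by rewrite subnKC// leq_sub2l.
by rewrite expnD !divnMA => /eqP ->.
Qed.

Lemma meet_le p q : (meet p q <= n.+1)%N.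
Proof.
rewrite /meet -[X in (_ <= X)%N](card_ord n.+1) -sum1_card.
by apply: leq_sum => k _; case: (_ == _).
Qed.

(** Leaves below the same vertex of level [i] have the same quotient by [2 ^ (n - i)], so their
    remainders separate them. *)
Lemma card_anc_eq p (i : 'I_n.+1) :
  (#|[pred q : 'I_(2 ^ n) | anc p i == anc q i]| <= 2 ^ (n - i))%N.
Proof.
have d0 : (0 < 2 ^ (n - i))%N by rewrite expn_gt0.
pose f (q : 'I_(2 ^ n)) := Ordinal (ltn_pmod q d0).
rewrite -[X in (_ <= X)%N](card_ord (2 ^ (n - i))).
rewrite -(@card_in_image _ _ f) ?max_card// => q q'.
rewrite !inE !anc_eqE => /eqP pq /eqP pq' [qq']; apply: val_inj => /=.
by rewrite (divn_eq q (2 ^ (n - i))) (divn_eq q' (2 ^ (n - i))) -pq -pq' qq'.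
Qed.

Variable R : realType.
Implicit Type r : R.

(** A telescoping sum over the shared levels. Written with indicators, it can be summed over [q] by
    counting leaves level by level. *)
Lemma expr_meet p q r :
  r ^+ meet p q = 1 + \sum_(i < n.+1) (r - 1) * r ^+ i *+ (anc p i == anc q i).
Proof.
under eq_bigr do rewrite anc_eq_meet.
rewrite -(big_mkord xpredT (fun i => (r - 1) * r ^+ i *+ (i < meet p q)%N)).
rewrite (big_cat_nat (leq0n _) (meet_le p q))//=.
have -> : \sum_(meet p q <= i < n.+1) (r - 1) * r ^+ i *+ (i < meet p q)%N = 0.
  by rewrite big_nat_cond big1// => i /andP[/andP[]]; rewrite leqNgt => /negbTE ->.
rewrite addr0 (eq_big_nat _ _ (F2 := fun i => (r - 1) * r ^+ i)); last first.
  by move=> i /andP[_ ->].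
by rewrite big_mkord -mulr_sumr -subrX1; ring.
Qed.

(** Level [i] has weight [(r - 1) * r ^+ i] and at most [2 ^ (n - i)] leaves [q], which leaves a
    geometric series of ratio [r / 2 < 1]. *)
Lemma sum_expr_meet p r : 1 <= r -> r < 2 ->
  \sum_q r ^+ meet p q <= (2 ^ n)%:R * (r / (2 - r)).
Proof.
move=> r1 r2; under eq_bigr do rewrite expr_meet.
rewrite big_split /= sumr_const card_ord exchange_big /=.
have -> : r / (2 - r) = 1 + (r - 1) * (2 / (2 - r)).
  by field; rewrite subr_eq0 gt_eqF.
rewrite mulrDr mulr1 lerD2l.
apply: (@le_trans _ _ (\sum_(i < n.+1) (2 ^ n)%:R * (r - 1) * (r / 2) ^+ i)).
  apply: ler_sum => i _.
  rewrite sumrMnr -[leLHS]mulr_natr exprMn exprVn.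
  have -> : (2 ^ n)%:R * (r - 1) * (r ^+ i / 2 ^+ i) =
      (r - 1) * r ^+ i * (2 ^ (n - i))%:R :> R.
    have -> : (2 ^ n)%:R = 2 ^+ (n - i) * 2 ^+ i :> R.
      by rewrite -exprD subnK ?natrX// -ltnS.
    rewrite natrX.
    by field; rewrite expf_neq0.
  apply: ler_wpM2l; last first.
    rewrite ler_nat (leq_trans _ (card_anc_eq p i))// -sum1_card [leqRHS]big_mkcond /=.
    by apply: leq_sum => q _; rewrite inE; case: eqP.
  by rewrite mulr_ge0 ?subr_ge0// exprn_ge0// (le_trans ler01).
rewrite -mulr_sumr -mulrA ler_wpM2l// ler_wpM2l ?subr_ge0//.
have r20 : 0 < 2 - r by rewrite subr_gt0.
rewrite ler_pdivlMr// -[leRHS]mulr1.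
have e := subrX1 (r / 2) n.+1.
have : 0 <= (r / 2) ^+ n.+1 by rewrite exprn_ge0// divr_ge0// (le_trans ler01).
set S := \sum_(i < n.+1) _ in e *; set t := _ ^+ _ in e * => t0.
have -> : S * (2 - r) = 2 * (1 - t) by lra.
lra.
Qed.

End meet.

(** * Exponential moments along paths *)

Section path_expectation.
Context {R : realType}.
Local Notation mfun f := (measurable_fun setT (f : coordT -> R)).

Lemma Egauss_expR_affine (V : finType) (mu a b : V -> R) :
  Egauss mu (fun x => expR (\sum_v (a v * x v - b v))) =
  (expR (\sum_v (a v * mu v + a v ^+ 2 / 2 - b v)))%:E.
Proof.
have mE : mfun (fun x : V -> R => expR (\sum_v a v * x v)).
  have := measurable_expR_coord_sum (index_enum V) a (fun=> 0).
  by apply: eq_measurable_fun => x _; under eq_bigr do rewrite subr0.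
under eq_Egauss do rewrite sumrB addrC expRD.
rewrite (EgaussZ _ mE (fun=> expR_ge0 _))//.
by rewrite Egauss_expR -EFinM -expRD sumrB addrC.
Qed.

Variable m : nat.
Implicit Types (q : nat) (B : pred 'I_m) (mu s b : R).

Lemma mean_path_of mu q (v : vert m) :
  mean_path mu (path_of q) v = mu * (on_path q v)%:R.
Proof. by rewrite /mean_path mem_path_of; case: ifP; rewrite ?mulr1 ?mulr0. Qed.

Lemma path_sum_affine B q s b (x : vert m -> R) :
  \sum_(i | B i) (s * x (anc q i) - b) =
  \sum_v (s * (B (tag v) && on_path q v)%:R * x v -
          b * (B (tag v) && on_path q v)%:R).
Proof.
rewrite -(big_on_path (fun v => s * x v - b)) big_mkcond; apply: eq_bigr => v _.
by case: ifP => _; rewrite ?mulr1 ?mulr0 ?mul0r ?subr0.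
Qed.

Lemma measurable_path_sum B q s b :
  mfun (fun x => \sum_(i | B i) (s * x (anc q i) - b)).
Proof.
have := @measurable_coord_sum R (vert m) (index_enum _)
  (fun v => s * (B (tag v) && on_path q v)%:R)
  (fun v => b * (B (tag v) && on_path q v)%:R).
by apply: eq_measurable_fun => x _; rewrite path_sum_affine.
Qed.

Lemma measurable_expR_path_sum B q s b :
  mfun (fun x => expR (\sum_(i | B i) (s * x (anc q i) - b))).
Proof. by apply: measurableT_comp => //; exact: measurable_path_sum. Qed.

(** Each selected vertex contributes an independent N(mu, 1) moment. The case [mu = 0] covers the
    null law. *)
Lemma Egauss_path_expR mu q B s b :
  Egauss (mean_path mu (path_of q))
    (fun x => expR (\sum_(i | B i) (s * x (anc q i) - b))) =
  (expR ((s * mu + s ^+ 2 / 2 - b) *+ #|B|))%:E.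
Proof.
under eq_Egauss do rewrite path_sum_affine.
rewrite Egauss_expR_affine; congr (expR _)%:E.
rewrite -sumr_const -(big_on_path (fun=> s * mu + s ^+ 2 / 2 - b) _ q).
rewrite [RHS]big_mkcond; apply: eq_bigr => v _; rewrite mean_path_of.
have -> : (tag v \in B) = B (tag v) by [].
by case: (B _); case: (on_path _ _); rewrite /= ?mulr1n ?mulr0n; field.
Qed.

Definition path_lik mu q : (vert m -> R) -> R := lik (mean_path mu (path_of q)).

Lemma Egauss_path_lik mu q : Egauss (fun=> 0) (path_lik mu q) = 1%E.
Proof.
have := Egauss_cst (mean_path mu (path_of q) : vert m -> R) ler01.
by rewrite Egauss_lik// => <-; apply: eq_Egauss => x; rewrite mul1r.
Qed.

End path_expectation.

(** A vertex on only one path contributes exponent 0, since each likelihood has mean 1; a shared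
    vertex has linear coefficient [2 * mu - theta] and constant [- mu ^+ 2]. Taking [theta = 0]
    gives the plain second moment. *)
Lemma Egauss_lik_meet (R : realType) n (mu theta : R) (p q : 'I_(2 ^ n)) :
  Egauss (fun=> 0) (fun x : vert n.+1 -> R => path_lik mu p x * path_lik mu q x *
     expR (- theta * \sum_(i < n.+1 | anc p i == anc q i) x (anc p i))) =
  (expR (((2 * mu - theta) ^+ 2 / 2 - mu ^+ 2) *+ meet p q))%:E.
Proof.
pose c (v : vert n.+1) : R :=
  ((anc p (tag v) == anc q (tag v)) && on_path p v)%:R.
pose a (v : vert n.+1) := mean_path mu (path_of p) v + mean_path mu (path_of q) v - theta * c v.
pose b (v : vert n.+1) := mean_path mu (path_of p) v ^+ 2 / 2 + mean_path mu (path_of q) v ^+ 2 / 2.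
transitivity (Egauss (fun=> 0) (fun x => expR (\sum_v (a v * x v - b v)))).
  apply: eq_Egauss => x; rewrite /path_lik /lik -!expRD; congr expR.
  rewrite -(big_on_path x (fun i => anc p i == anc q i)).
  rewrite [X in - theta * X]big_mkcond mulr_sumr.
  rewrite -!big_split /=. apply: eq_bigr => v _; rewrite /a /b /c.
  by case: ifP => _; rewrite ?mulr1n ?mulr0n; field.
rewrite Egauss_expR_affine; congr (expR _)%:E.
rewrite /meet; transitivity
  (\sum_(i < n.+1 | anc p i == anc q i) ((2 * mu - theta) ^+ 2 / 2 - mu ^+ 2)).
  rewrite -(big_on_path (fun=> (2 * mu - theta) ^+ 2 / 2 - mu ^+ 2) _ p).
  rewrite [RHS]big_mkcond; apply: eq_bigr => v _.
  rewrite /a /b /c !mean_path_of /on_path.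
  have [->|pq] := eqVneq (anc p (tag v)) (anc q (tag v)).
    by case: eqP => _; rewrite /= ?mulr1n ?mulr0n; field.
  have [vp|_] := eqVneq v (anc p (tag v)); have [vq|_] := eqVneq v (anc q (tag v));
    rewrite /= ?andbF ?mulr1n ?mulr0n; try by field.
  by rewrite -vp -vq eqxx in pq.
rewrite big_mkcond -sumrMnr; apply: eq_bigr => i _.
by case: eqP; rewrite ?mulr1n ?mulr0n.
Qed.

(** * Lower bounds on the risk *)

Section lower_bound.
Context {R : realType}.
Local Notation mfun f := (measurable_fun setT (f : coordT -> R)).

Lemma gauss_prob_bool (V : finType) (mu : V -> R) (b : (V -> R) -> bool) :
  gauss_prob mu [set x | b x] = Egauss mu (fun x => (b x)%:R).
Proof. by rewrite gauss_probE; apply: eq_Egauss => x; rewrite indicE mem_setE. Qed.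

Lemma measurable_bool (V : finType) (b : (V -> R) -> bool) :
  coord_sigma [set x | b x] -> mfun (fun x => (b x)%:R).
Proof.
move=> mb; have : measurable_fun setT (\1_([set x | b x] : set (@coordT R V)) : _ -> R).
  exact: measurable_indic.
by apply: eq_measurable_fun => x _; rewrite indicE mem_setE.
Qed.

Lemma measurable_negb (V : finType) (b : (V -> R) -> bool) :
  coord_sigma [set x | b x] -> mfun (fun x => (~~ b x)%:R).
Proof.
move=> mb; apply: measurable_bool.
rewrite (_ : [set x | ~~ b x] = ~` [set x | b x]).
  exact: (@measurableC _ (@coordT R V)).
by apply/seteqP; split => x /= /negP.
Qed.

Lemma Egauss_bool_le1 (V : finType) (mu : V -> R) (b : (V -> R) -> bool) :
  mfun (fun x => (b x)%:R) -> (Egauss mu (fun x => (b x)%:R) <= 1)%E.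
Proof.
move=> mb; rewrite -(Egauss_cst mu ler01); apply: Egauss_le => // x.
by rewrite lern1 leq_b1.
Qed.

Variable n : nat.
Local Notation M := (2 ^ n)%N.
Implicit Types (T : (vert n.+1 -> R) -> bool) (mu : R).

Let M_gt0 : 0 < M%:R :> R.
Proof. by rewrite ltr0n expn_gt0. Qed.

(** For [F = path_lik mu] this is the likelihood ratio of the uniform mixture over paths. *)
Definition avg (F : 'I_M -> (vert n.+1 -> R) -> R) (x : vert n.+1 -> R) : R :=
  M%:R^-1 * \sum_q F q x.

Lemma measurable_avg F : (forall q, mfun (F q)) -> mfun (avg F).
Proof. by move=> mF; apply: measurable_funM => //; exact: measurable_sum. Qed.

Lemma avg_ge0 F : (forall q x, 0 <= F q x) -> forall x, 0 <= avg F x.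
Proof. by move=> F0 x; rewrite mulr_ge0 ?invr_ge0 ?ler0n ?sumr_ge0. Qed.

Lemma Egauss_avg (mu : vert n.+1 -> R) F :
    (forall q, mfun (F q)) -> (forall q x, 0 <= F q x) ->
  Egauss mu (avg F) = (M%:R^-1%:E * \sum_q Egauss mu (F q))%E.
Proof.
move=> mF F0; rewrite EgaussZ ?invr_ge0 ?ler0n//; last 2 first.
- exact: measurable_sum.
- by move=> x; exact: sumr_ge0.
by rewrite Egauss_sum.
Qed.

(** The worst path is at least as bad as a uniformly random one, and the average type II error is a
    null expectation weighted by the mixture likelihood. *)
Lemma risk_ge mu T : is_test T ->
  (Egauss (fun=> 0%R)
     (fun x => (T x)%:R + (~~ T x)%:R * avg (path_lik mu) x)%R <= risk mu T)%E.
Proof.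
move=> mT; have mT1 := measurable_bool mT; have mT0 := measurable_negb mT.
have mL : mfun (avg (path_lik mu)).
  by apply: measurable_avg => q; exact: measurable_lik.
have L0 : forall x, 0 <= avg (path_lik mu) x.
  by apply: avg_ge0 => q x; exact: lik_ge0.
rewrite EgaussD//; last 2 first.
- exact: measurable_funM.
- by move=> x; rewrite mulr_ge0.
rewrite /risk gauss_prob_bool leeD2l//.
set s := ereal_sup _.
have le_s (q : 'I_M) : (Egauss (mean_path mu (path_of q : seq (vert n.+1)))
    (fun x => (~~ T x)%:R) <= s)%E.
  rewrite -gauss_prob_bool; apply: ereal_sup_ubound; exists (path_of q) => //.
  exact: is_tree_path_of.
(* The supremum must be known to be finite before its real value can be averaged over the paths. *)
have s_le1 : (s <= 1)%E.
  by apply: ge_ereal_sup => _ [p _ <-]; rewrite gauss_prob_bool Egauss_bool_le1.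
have q0 : 'I_M by exists 0%N; rewrite expn_gt0.
have sfin : s \is a fin_num.
  rewrite ge0_fin_numE ?(le_lt_trans s_le1) ?ltry//.
  by apply: le_trans (le_s q0); exact: Egauss_ge0.
under eq_Egauss do rewrite /avg mulrCA mulr_sumr.
rewrite -/(avg (fun q x => (~~ T x)%:R * path_lik mu q x)) Egauss_avg; last 2 first.
- by move=> q; apply: measurable_funM => //; exact: measurable_lik.
- by move=> q x; rewrite mulr_ge0// lik_ge0.
apply: (@le_trans _ _ (M%:R^-1%:E * \sum_(q < M) (fine s)%:E)%E).
  rewrite lee_wpmul2l ?lee_fin ?invr_ge0 ?ler0n//; apply: lee_sum => q _.
  by rewrite fineK// -Egauss_lik.
rewrite sumEFin sumr_const card_ord -EFinM -[fine s *+ _]mulr_natl mulKf ?fineK//.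
Qed.

(** The square expands into a double average over pairs of paths; for each fixed [p],
    [sum_expr_meet] bounds the average over [q]. *)
Lemma avg_second_moment (F : 'I_M -> (vert n.+1 -> R) -> R) (C r : R) :
    (forall q, mfun (F q)) -> (forall q x, 0 <= F q x) ->
    (forall p q, Egauss (fun=> 0%R) (fun x => F p x * F q x)%R <=
       (C * r ^+ meet p q)%:E)%E ->
    0 <= C -> 1 <= r -> r < 2 ->
  (Egauss (fun=> 0%R) (fun x => avg F x ^+ 2)%R <= (C * (r / (2 - r)))%:E)%E.
Proof.
move=> mF F0 FE C0 r1 r2.
have mFF p q : mfun (fun x => F p x * F q x) by exact: measurable_funM.
have mA p : mfun (avg (fun q x => F p x * F q x)) by exact: measurable_avg.
have A0 p x : 0 <= avg (fun q x => F p x * F q x) x.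
  by apply: avg_ge0 => q y; rewrite mulr_ge0.
have -> : (fun x => avg F x ^+ 2) = avg (fun p => avg (fun q x => F p x * F q x)).
  apply/funext => x; rewrite /avg expr2 -mulrA; congr (_ * _).
  rewrite mulr_suml; apply: eq_bigr => p _.
  by rewrite mulrCA mulr_sumr.
rewrite Egauss_avg// lee_pdivrMl//.
apply: (@le_trans _ _ (\sum_(p < M) (C * (r / (2 - r)))%:E)%E).
  apply: lee_sum => p _; rewrite Egauss_avg//; last by move=> q x; rewrite mulr_ge0.
  rewrite lee_pdivrMl//.
  apply: (@le_trans _ _ (\sum_(q < M) (C * r ^+ meet p q)%:E)%E).
    by apply: lee_sum => q _; exact: FE.
  rewrite sumEFin -EFinM lee_fin -mulr_sumr mulrCA ler_wpM2l//.
  exact: sum_expr_meet.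
by rewrite sumEFin sumr_const card_ord -EFinM mulr_natl.
Qed.

(** Pointwise, the integrand of [risk_ge] is at least [1 - |L - 1|]. The inequality
    [|u| <= e + u ^+ 2 / (4 * e)] then replaces the absolute value by the variance of [L]. *)
Lemma risk_ge_second_moment mu T (e : R) : is_test T -> 0 < e -> expR (mu ^+ 2) < 2 ->
  (1 <= risk mu T +
    (e + (expR (mu ^+ 2) / (2 - expR (mu ^+ 2)) - 1) / (4 * e))%:E)%E.
Proof.
move=> mT e0; set r := expR _ => r2; set s := r / (2 - r).
have mT1 := measurable_bool mT; have mT0 := measurable_negb mT.
have r1 : 1 <= r by rewrite -expR0 ler_expR sqr_ge0.
pose L := avg (path_lik mu).
have mL : mfun L by apply: measurable_avg => q; exact: measurable_lik.
have L0 : forall x, 0 <= L x by apply: avg_ge0 => q x; exact: lik_ge0.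
have EL : Egauss (fun=> 0) L = 1%E.
  rewrite /L Egauss_avg; last 2 first.
  - by move=> q; exact: measurable_lik.
  - by move=> q x; exact: lik_ge0.
  under eq_bigr do rewrite Egauss_path_lik.
  by rewrite sumEFin sumr_const card_ord -EFinM mulVf// gt_eqF.
have EL2 : (Egauss (fun=> 0%R) (fun x => L x ^+ 2)%R <= s%:E)%E.
  rewrite -[s]mul1r; apply: avg_second_moment => //.
  - by move=> q; exact: measurable_lik.
  - by move=> q x; exact: lik_ge0.
  - move=> p q; have := Egauss_lik_meet mu 0 p q.
    under eq_Egauss do rewrite oppr0 mul0r expR0 mulr1.
    move=> ->; rewrite lee_fin mul1r /r -expRM_natl -mulr_natl.
    by rewrite ler_expR; lra.
have mD : mfun (fun x => (L x - 1) ^+ 2).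
  by apply: measurable_funX => //; exact: measurable_funB.
have mL2 : mfun (fun x => L x ^+ 2) by exact: measurable_funX.
have ED : (Egauss (fun=> 0%R) (fun x => (L x - 1) ^+ 2)%R <= (s - 1)%:E)%E.
  (* The expansion of the square is arranged without subtraction, since [EgaussD] requires
     nonnegative terms. *)
  have : Egauss (fun=> 0) (fun x => (L x - 1) ^+ 2 + 2 * L x) =
         Egauss (fun=> 0) (fun x => L x ^+ 2 + 1).
    by apply: eq_Egauss => x; ring.
  rewrite EgaussD//; last 3 first.
  - exact: measurable_funM.
  - by move=> x; rewrite sqr_ge0.
  - by move=> x; rewrite mulr_ge0.
  rewrite EgaussZ// EL EgaussD//; last by move=> x; rewrite sqr_ge0.
  rewrite Egauss_cst// mule1 => e2.
  rewrite EFinB leeBrDr// -(leeD2rE _ _ (_ : 1%:E \is a fin_num))//.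
  rewrite -addeA -EFinD -natr1 in e2 *.
  by rewrite e2 leeD2r.
apply: (@le_trans _ _ (Egauss (fun=> 0%R) (fun x =>
    ((T x)%:R + (~~ T x)%:R * L x) + (e + (4 * e)^-1 * (L x - 1) ^+ 2))%R)).
  rewrite -(Egauss_cst (fun _ : vert n.+1 => 0 : R) ler01); apply: Egauss_le => //.
    apply: measurable_funD.
      by apply: measurable_funD => //; exact: measurable_funM.
    by apply: measurable_funD => //; exact: measurable_funM.
  move=> x; have e4 : 0 < (4 * e)^-1 by rewrite invr_gt0 mulr_gt0.
  case: (T x) => /=.
    by rewrite mul0r addr0 lerDl addr_ge0 ?(ltW e0)// mulr_ge0 ?sqr_ge0 ?ltW.
  rewrite add0r mul1r -subr_ge0.
  have -> : L x + (e + (4 * e)^-1 * (L x - 1) ^+ 2) - 1 =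
    (4 * e)^-1 * (L x - 1 + 2 * e) ^+ 2 by field; rewrite gt_eqF.
  by rewrite mulr_ge0 ?sqr_ge0 ?ltW.
rewrite EgaussD; last 4 first.
- by apply: measurable_funD => //; exact: measurable_funM.
- by apply: measurable_funD => //; exact: measurable_funM.
- by move=> x; rewrite addr_ge0// mulr_ge0.
- by move=> x; rewrite addr_ge0 ?(ltW e0)// mulr_ge0 ?sqr_ge0// invr_ge0 mulr_ge0// ltW.
apply: leeD; first exact: risk_ge.
rewrite EgaussD//; last 3 first.
- exact: measurable_funM.
- by move=> x; exact: ltW.
- by move=> x; rewrite mulr_ge0 ?sqr_ge0// invr_ge0 mulr_ge0// ltW.
rewrite Egauss_cst ?(ltW e0)// EgaussZ//; last 2 first.
- by move=> x; rewrite sqr_ge0.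
- by rewrite invr_ge0 mulr_ge0// ltW.
rewrite EFinD leeD2l// (mulrC (s - 1)) EFinM lee_wpmul2l// lee_fin.
by rewrite invr_ge0 mulr_ge0// ltW.
Qed.

End lower_bound.

Lemma prod_natr_bool (R : realType) (I : finType) (b : I -> bool) :
  \prod_i (b i)%:R = [forall i, b i]%:R :> R.
Proof.
have [/forallP ball|/forallPn[i nbi]] := boolP [forall i, b i].
  by apply: big1 => i _; rewrite ball.
by rewrite (bigD1 i)//= (negbTE nbi) mul0r.
Qed.

Lemma coord_sigma_itv (R : realType) (V : finType) (h : coordT -> R) (i : interval R) :
  measurable_fun setT h -> @coord_sigma R V [set x | h x \in i].
Proof. by move=> mh; have := mh measurableT _ (measurable_itv i); rewrite setTI. Qed.

(** * Second moment of the truncated likelihoods *)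

Section truncated_second_moment.
Context {R : realType}.
Local Notation mfun f := (measurable_fun setT (f : coordT -> R)).
Variables (n : nat) (mu eps A : R).
Hypothesis eps_gt0 : 0 < eps.
Local Notation M := (2 ^ n)%N.
Implicit Types (q : 'I_M) (x : vert n.+1 -> R).

(* [eps] times the excess of the partial sum over the first [k] vertices
   above its allowed drift [(mu + eps) k]. *)
Definition excess k q x : R :=
  \sum_(i < n.+1 | (i < k)%N) (eps * x (anc q i) - eps * (mu + eps)).

(** The index runs up to [n.+1] included, so that two identical paths, with [meet] equal to [n.+1],
    are covered too. *)
Definition low_path q x : bool :=
  [forall k : 'I_n.+2, excess k q x <= eps * A].

Lemma measurable_excess k q : mfun (excess k q).
Proof. exact: measurable_path_sum. Qed.

Lemma measurable_low_path q : mfun (fun x => (low_path q x)%:R).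
Proof.
have : mfun (fun x => \prod_(k < n.+2) (excess k q x \in `]-oo, eps * A])%:R).
  apply: measurable_prod => k _; apply: measurable_bool.
  by apply: coord_sigma_itv; exact: measurable_excess.
apply: eq_measurable_fun => x _; rewrite -prod_natr_bool.
by apply: eq_bigr => k _; rewrite in_itv.
Qed.

(** Union bound in exponential Markov form: if some [k] violates the constraint, its exponential
    alone exceeds 1. *)
Lemma low_pathC q x :
  1 <= (low_path q x)%:R + \sum_(k < n.+2) expR (excess k q x - eps * A).
Proof.
rewrite /low_path; case: (boolP [forall _, _]) => [_|/forallPn[k]].
  by rewrite lerDl sumr_ge0// => k _; exact: expR_ge0.
rewrite -ltNge => kA; rewrite add0r (bigD1 k)//=.
apply: ler_wpDr; first by rewrite sumr_ge0// => j _; exact: expR_ge0.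
by rewrite -expR0 ler_expR subr_ge0 ltW.
Qed.

(** Each vertex contributes the exponent [eps * mu + eps ^+ 2 / 2 - eps * (mu + eps) = - (eps ^+ 2 /
    2)], hence a geometric decay in [k]. *)
Lemma Egauss_excess k q : (k <= n.+1)%N ->
  Egauss (mean_path mu (path_of q)) (fun x => expR (excess k q x - eps * A)) =
  (expR (- eps * A) * expR (- (eps ^+ 2 / 2)) ^+ k)%:E.
Proof.
move=> kn; under eq_Egauss do rewrite addrC expRD /excess.
rewrite (EgaussZ _ (measurable_expR_path_sum _ _ _ _) (fun=> expR_ge0 _))//.
rewrite Egauss_path_expR -EFinM mulNr -expRM_natl -mulr_natl; congr (_ * expR _)%:E.
rewrite (_ : #|_| = k).
  by field.
rewrite -sum1_card -(big_ord_widen _ (fun=> 1%N) kn) sum1_card card_ord//.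
Qed.

(** With this choice of [A] the full geometric series of violation probabilities sums to 1/2. *)
Hypothesis A_def : expR (- eps * A) = (1 - expR (- (eps ^+ 2 / 2))) / 2.

Lemma Egauss_low_path q :
  (2^-1%:E <= Egauss (mean_path mu (path_of q)) (fun x => (low_path q x)%:R))%E.
Proof.
set P := Egauss _ _; have A_def' := A_def.
set rho := expR (- (eps ^+ 2 / 2)) in A_def' *.
have rho1 : rho < 1 by rewrite -expR0 ltr_expR oppr_lt0 divr_gt0// exprn_gt0.
have : (1 <= P + 2^-1%:E)%E.
  rewrite -(Egauss_cst (mean_path mu (path_of q) : vert n.+1 -> R) ler01).
  apply: (@le_trans _ _ (Egauss (mean_path mu (path_of q)) (fun x =>
     (low_path q x)%:R + \sum_(k < n.+2) expR (excess k q x - eps * A)))).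
    apply: Egauss_le => //.
    - apply: measurable_funD; first exact: measurable_low_path.
      apply: measurable_sum => k; apply: measurableT_comp => //.
      by apply: measurable_funB => //; exact: measurable_excess.
    - exact: low_pathC.
  have mE (k : 'I_n.+2) : mfun (fun x => expR (excess k q x - eps * A)).
    apply: measurableT_comp => //.
    by apply: measurable_funB => //; exact: measurable_excess.
  rewrite EgaussD//; last 3 first.
  - exact: measurable_low_path.
  - exact: measurable_sum.
  - by move=> x; rewrite sumr_ge0// => k _; exact: expR_ge0.
  rewrite Egauss_sum//.
  rewrite leeD2l//.
  under eq_bigr => k _ do rewrite Egauss_excess -1?ltnS//.
  rewrite sumEFin lee_fin -mulr_sumr A_def'.
  have := subrX1 rho n.+2.
  set S := \sum_(i < _) _ => e.
  have : 0 <= rho ^+ n.+2 by rewrite exprn_ge0// expR_ge0.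
  nra.
have : (0 <= P)%E.
  by apply: Egauss_ge0.
case: P => [p||]//= _; last by move=> _; rewrite leey.
by rewrite -EFinD !lee_fin => ?; lra.
Qed.

Definition trunc_lik q x : R := path_lik mu q x * (low_path q x)%:R.

Lemma trunc_lik_ge0 q x : 0 <= trunc_lik q x.
Proof. by rewrite mulr_ge0// lik_ge0. Qed.

Lemma measurable_trunc_lik q : mfun (trunc_lik q).
Proof.
by apply: measurable_funM; [exact: measurable_lik|exact: measurable_low_path].
Qed.

(* Exponential tilting by [theta = mu - eps] is optimal here: the truncation
   replaces the rate [mu ^ 2] of the plain second moment by
   [(mu + eps) ^ 2 / 2 - eps ^ 2]. *)
Lemma Egauss_trunc_lik p q : eps <= mu ->
  (Egauss (fun=> 0%R) (fun x => trunc_lik p x * trunc_lik q x)%R <=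
   (expR ((mu - eps) * A) * expR ((mu + eps) ^+ 2 / 2) ^+ meet p q)%:E)%E.
Proof.
move=> emu; pose theta := mu - eps.
have theta0 : 0 <= theta by rewrite subr_ge0.
set K := meet p q.
pose f x := path_lik mu p x * path_lik mu q x *
     expR (- theta * \sum_(i < n.+1 | anc p i == anc q i) x (anc p i)).
have mS : mfun (fun x => \sum_(i < n.+1 | anc p i == anc q i) x (anc p i)).
  have := @measurable_path_sum R n.+1 (fun i => anc p i == anc q i) p 1 0.
  by apply: eq_measurable_fun => x _; apply: eq_bigr => i _; rewrite mul1r subr0.
have mf : mfun f.
  apply: measurable_funM.
    by apply: measurable_funM; exact: measurable_lik.
  by apply: measurableT_comp => //; exact: measurable_funM.
have f0 x : 0 <= f x by rewrite !mulr_ge0 ?lik_ge0 ?expR_ge0.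
(* On [low_path p], the constraint at [k = K] bounds the sum over the shared vertices by
   [A + (mu + eps) * K], so [c] compensates the tilting factor in [f]. *)
pose c := expR (theta * A + theta * (mu + eps) * K%:R).
apply: (@le_trans _ _ (Egauss (fun=> 0) (fun x => c * f x))).
  apply: Egauss_le => //.
  - by apply: measurable_funM; exact: measurable_trunc_lik.
  - exact: measurable_funM.
  - by move=> x; rewrite mulr_ge0// trunc_lik_ge0.
  move=> x; rewrite /trunc_lik mulrACA /f [leRHS]mulrCA ler_wpM2l ?mulr_ge0 ?lik_ge0//.
  (* One truncation suffices for the shared segment; the indicator for [q] is bounded by 1. *)
  apply: (@le_trans _ _ (low_path p x)%:R).
    by rewrite ler_piMr// lern1 leq_b1.
  rewrite -expRD; case: (boolP (low_path p x)) => [/forallP low|_]; last exact: expR_ge0.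
  have Kn : (K < n.+2)%N by rewrite ltnS meet_le.
  have := low (Ordinal Kn); rewrite /excess /=.
  under eq_bigl do rewrite -anc_eq_meet.
  rewrite sumrB -mulr_sumr sumr_const (_ : #|_| = K); last first.
    rewrite -sum1_card big_mkcond; apply: eq_bigr => i _.
    by have -> : (i \in (fun i => anc p i == anc q i)) = (anc p i == anc q i) by []; case: eqP.
  set S := \sum_(_ < _ | _) _; rewrite -[_ *+ K]mulr_natr -mulrA -mulrBr ler_pM2l// => SA.
  rewrite -[X in X <= _]expR0 ler_expR.
  have : 0 <= theta * (A - (S - (mu + eps) * K%:R)) by rewrite mulr_ge0// subr_ge0.
  by congr (_ <= _); ring.
rewrite EgaussZ ?expR_ge0// Egauss_lik_meet -EFinM lee_fin /c expRD -[leLHS]mulrA.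
(* The exponents combine to [(mu + eps) ^+ 2 / 2 - eps ^+ 2] per shared vertex; the negative term is
   discarded. *)
rewrite ler_wpM2l ?expR_ge0// -expRD -expRM_natl ler_expR.
rewrite -[_ *+ meet p q]mulr_natl -/K -subr_ge0.
have := mulr_ge0 (ler0n R K) (sqr_ge0 eps); rewrite /theta.
by set k := K%:R; lra.
Qed.

End truncated_second_moment.

(** * Impossibility for subcritical and for vanishing means *)

Section impossibility.
Context {R : realType}.
Local Notation mfun f := (measurable_fun setT (f : coordT -> R)).

(** Where [T] rejects, [Lt <= 2 * C + Lt ^+ 2 / (8 * C)]; where it accepts, [Lt <= L]. Taking
    expectations, 1/2 is at most [1 + 2 * C] times the risk, plus 1/8. *)
Lemma risk_ge_truncated n (mu eps A C : R) (T : (vert n.+1 -> R) -> bool) :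
    is_test T -> 0 < eps -> eps <= mu ->
    expR (- eps * A) = (1 - expR (- (eps ^+ 2 / 2))) / 2 ->
    expR ((mu + eps) ^+ 2 / 2) < 2 ->
    C = expR ((mu - eps) * A) *
      (expR ((mu + eps) ^+ 2 / 2) / (2 - expR ((mu + eps) ^+ 2 / 2))) ->
  ((3 / 8)%:E <= (1 + 2 * C)%:E * risk mu T)%E.
Proof.
move=> mT e0 emu eA; set r := expR ((mu + eps) ^+ 2 / 2) => r2 CE.
have r1 : 1 <= r by rewrite -expR0 ler_expR divr_ge0// sqr_ge0.
have C0 : 0 < C.
  by rewrite CE mulr_gt0 ?expR_gt0// divr_gt0 ?subr_gt0// (lt_le_trans ltr01).
have mT1 := measurable_bool mT; have mT0 := measurable_negb mT.
pose Lt := avg (@trunc_lik R n mu eps A); pose L := avg (@path_lik R n.+1 mu).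
have mLt : mfun Lt by apply: measurable_avg => q; exact: measurable_trunc_lik.
have Lt0 : forall x, 0 <= Lt x by apply: avg_ge0 => q x; exact: trunc_lik_ge0.
have mL : mfun L by apply: measurable_avg => q; exact: measurable_lik.
have L0 : forall x, 0 <= L x by apply: avg_ge0 => q x; exact: lik_ge0.
have LtL x : Lt x <= L x.
  rewrite ler_wpM2l ?invr_ge0 ?ler0n//; apply: ler_sum => q _.
  by rewrite ler_piMr ?lik_ge0// lern1 leq_b1.
have mLt2 : mfun (fun x => Lt x ^+ 2) by exact: measurable_funX.
have mB : mfun (fun x => (T x)%:R + (~~ T x)%:R * L x).
  by apply: measurable_funD => //; exact: measurable_funM.
have B0 x : 0 <= (T x)%:R + (~~ T x)%:R * L x by rewrite addr_ge0// mulr_ge0.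
have ELt2 : (Egauss (fun=> 0%R) (fun x => Lt x ^+ 2)%R <= C%:E)%E.
  rewrite CE; apply: avg_second_moment => //.
  - by move=> q; exact: measurable_trunc_lik.
  - by move=> q x; exact: trunc_lik_ge0.
  - by move=> p q; exact: Egauss_trunc_lik.
have ELt : (2^-1%:E <= Egauss (fun=> 0%R) Lt)%E.
  rewrite /Lt Egauss_avg; last 2 first.
  - by move=> q; exact: measurable_trunc_lik.
  - by move=> q x; exact: trunc_lik_ge0.
  rewrite lee_pdivlMl ?ltr0n ?expn_gt0//.
  apply: (@le_trans _ _ (\sum_(q < 2 ^ n) 2^-1%:E)%E).
    by rewrite sumEFin sumr_const card_ord -EFinM mulr_natl.
  apply: lee_sum => q _. apply: (le_trans (Egauss_low_path mu e0 eA q)).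
  rewrite Egauss_lik//; last exact: measurable_low_path.
  rewrite le_eqVlt; apply/orP; left; apply/eqP; apply: eq_Egauss => x.
  by rewrite mulrC.
have b0 : 0 <= (8 * C)^-1 by rewrite invr_ge0 mulr_ge0// ltW.
have C1 : 0 <= 1 + 2 * C by rewrite addr_ge0// mulr_ge0// ltW.
have : (2^-1%:E <= (1 + 2 * C)%:E * risk mu T + 8^-1%:E)%E.
  apply: (le_trans ELt); apply: (@le_trans _ _ (Egauss (fun=> 0%R) (fun x =>
     (1 + 2 * C) * ((T x)%:R + (~~ T x)%:R * L x) + (8 * C)^-1 * Lt x ^+ 2)%R)).
    apply: Egauss_le => //.
      by apply: measurable_funD; exact: measurable_funM.
    move=> x; case: (T x) => /=.
      rewrite mul0r addr0 mulr1 -subr_ge0.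
      have -> : 1 + 2 * C + (8 * C)^-1 * Lt x ^+ 2 - Lt x =
        1 + (8 * C)^-1 * (Lt x - 4 * C) ^+ 2 by field; rewrite gt_eqF.
      by rewrite addr_ge0// mulr_ge0// sqr_ge0.
    rewrite add0r mul1r; apply: ler_wpDr; first by rewrite mulr_ge0// sqr_ge0.
    by apply: (le_trans (LtL x)); rewrite ler_peMl// lerDl mulr_ge0// ltW.
  rewrite EgaussD; last 4 first.
  - exact: measurable_funM.
  - exact: measurable_funM.
  - by move=> x; rewrite mulr_ge0.
  - by move=> x; rewrite mulr_ge0// sqr_ge0.
  rewrite EgaussZ// EgaussZ//; last by move=> x; rewrite sqr_ge0.
  apply: leeD; first by rewrite lee_wpmul2l ?lee_fin//; exact: risk_ge.
  have -> : 8^-1 = (8 * C)^-1 * C by field; rewrite gt_eqF.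
  by rewrite EFinM lee_wpmul2l.
case: (_ * _)%E => [u||]//=; last by move=> _; rewrite leey.
by rewrite -EFinD !lee_fin; lra.
Qed.

(** The constant [C] of [risk_ge_truncated] does not depend on the depth, so the risk stays bounded
    away from 0. *)
Lemma no_powerful_test (mu : R) (T : forall m, (vert m -> R) -> bool) :
    0 < mu -> mu < Num.sqrt (ln 2 *+ 2) -> (forall m, is_test (T m)) ->
  ~ (risk mu (T m) @[m --> \oo] --> (0:R)%:E).
Proof.
move=> mu0 mus mT.
pose s : R := Num.sqrt (ln 2 *+ 2).
have ln20 : 0 < ln 2 :> R by rewrite ln_gt0// ltr1n.
have s2 : s ^+ 2 = 2 * ln 2 by rewrite sqr_sqrtr ?mulr_natl// mulrn_wge0// ltW.
(* The first bound keeps the tilting [mu - eps] nonnegative, the second keeps [mu + eps] below the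
   critical value. *)
pose eps := Num.min mu ((s - mu) / 2).
have e0 : 0 < eps by rewrite lt_min mu0 divr_gt0// subr_gt0.
have emu : eps <= mu by rewrite ge_min lexx.
have es : mu + eps < s.
  have : eps <= (s - mu) / 2 by rewrite ge_min lexx orbT.
  by rewrite -/s in mus; lra.
have r2 : expR ((mu + eps) ^+ 2 / 2) < 2.
  rewrite -[ltRHS](@lnK R) ?posrE// ltr_expR.
  have : (mu + eps) ^+ 2 < s ^+ 2 by rewrite ltrXn2r// ?nnegrE; lra.
  by rewrite s2; lra.
pose y := (1 - expR (- (eps ^+ 2 / 2))) / 2.
have y0 : 0 < y.
  by rewrite divr_gt0// subr_gt0 -expR0 ltr_expR oppr_lt0 divr_gt0// exprn_gt0.
pose A := - (ln y / eps).
have eA : expR (- eps * A) = y.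
  by rewrite /A mulrNN mulrCA divff ?mulr1 ?lnK ?posrE// gt_eqF.
have := fun n => @risk_ge_truncated n mu eps A _ (T n.+1) (mT _) e0 emu eA r2 erefl.
set C := expR ((mu - eps) * A) * _ => low /fine_cvgP[[N1 _ fin] cv].
have C1 : 0 < 1 + 2 * C.
  rewrite ltr_wpDr// mulr_ge0// mulr_ge0 ?expR_ge0// divr_ge0 ?expR_ge0//.
  by rewrite subr_ge0 ltW.
have d0 : 0 < (3 / 8) / (1 + 2 * C) by rewrite !divr_gt0.
have [N2 _ small] := cvgr_lt _ cv _ d0.
pose n := maxn N1 N2.
have fn := fin n.+1 (leq_trans (leq_maxl N1 N2) (leqnSn n)).
have := low n; rewrite -(fineK fn) -EFinM lee_fin => h.
have := small n.+1 (leq_trans (leq_maxr N1 N2) (leqnSn n)).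
rewrite /= ltr_pdivlMr// [ltLHS]mulrC => lt.
by have := le_lt_trans h lt; rewrite ltxx.
Qed.

Lemma second_moment_limit (mu : nat -> R) (e : R) : mu @ \oo --> 0 -> 0 < e ->
  \forall m \near \oo, expR (mu m ^+ 2) < 2 /\
    expR (mu m ^+ 2) / (2 - expR (mu m ^+ 2)) - 1 <= 4 * e.
Proof.
move=> mu0 e0.
have cv : expR (mu m ^+ 2) @[m --> \oo] --> (1 : R).
  rewrite -(@expR0 R); apply: (@continuous_cvg _ _ _ _ _ (fun m => mu m ^+ 2) (@expR R)).
    exact: continuous_expR.
  have := cvgM mu0 mu0; rewrite mulr0; exact.
(* The cap 1/2 ensures [2 - r > 1 / 2], whence [r / (2 - r) - 1 = 2 * (r - 1) / (2 - r) <= 4 *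
   e]. *)
have d0 : 1 < 1 + Num.min e 2^-1 by rewrite ltrDl lt_min e0 invr_gt0 ltr0n.
have [N _ lt_d] := cvgr_lt _ cv _ d0.
exists N => // m /lt_d /=; set r := expR _ => rd.
have [re r2] : r < 1 + e /\ r < 1 + 2^-1.
  split; apply: (lt_le_trans rd); rewrite lerD2l ge_min lexx ?orbT//.
have r2' : 0 < 2 - r by lra.
split; first lra.
rewrite lerBlDr ler_pdivrMr//; nra.
Qed.

Lemma limn_einf_ge (u : nat -> \bar R) (c : R) :
  (\forall m \near \oo, c%:E <= u m)%E -> (c%:E <= limn_einf u)%E.
Proof.
move=> [N _ cu]; rewrite limn_einf_lim; apply: lime_ge; first exact: is_cvg_einfs.
exists N => // k /= Nk; rewrite /einfs; apply: le_ereal_inf_tmp => _ [j /= kj <-].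
by apply: cu => /=; exact: leq_trans kj.
Qed.

Lemma limn_einf_risk (mu : nat -> R) (T : forall m, (vert m -> R) -> bool) :
    mu @ \oo --> 0 -> (forall m, is_test (T m)) ->
  (1 <= limn_einf (fun m => risk (mu m) (T m)))%E.
Proof.
move=> mu0 mT; apply/lee_addgt0Pr => e e0.
have e20 : 0 < e / 2 by rewrite divr_gt0.
rewrite -leeBlDr// -EFinB; apply: limn_einf_ge.
(* In the bound used with parameter [e / 2], a variance of at most [4 * (e / 2) ^+ 2] costs a
   further [e / 2]. *)
have ee0 : 0 < (e / 2) ^+ 2 by rewrite exprn_gt0.
have := second_moment_limit mu0 ee0.
move=> [N _ small]; exists N.+1 => // -[//|n] /= Nn.
have [r2 rs] := small n.+1 (ltnW Nn).
have := risk_ge_second_moment (mT n.+1) e20 r2.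
rewrite EFinB leeBlDr// => h; apply: (le_trans h); rewrite leeD2l// lee_fin.
rewrite -lerBrDl ler_pdivrMr ?mulr_gt0//; apply: (le_trans rs).
by rewrite expr2; lra.
Qed.

End impossibility.

(** * The block scan test *)

(** The first level of block [j]. The quadratic block length gives the block sum a standard
    deviation proportional to [lev K j + K]. *)
Fixpoint lev (K j : nat) : nat :=
  if j is j'.+1 then (lev K j' + 2 * (lev K j' + K) ^ 2)%N else 0%N.

Lemma lev_homo K : {homo lev K : i j / (i <= j)%N}.
Proof. by apply: homo_leq => //= [? ? ?|j]; [exact: leq_trans|exact: leq_addr]. Qed.

Lemma card_block m a b : (b <= m)%N -> #|[pred i : 'I_m | a <= i < b]%N| = (b - a)%N.
Proof.
move=> bm; rewrite -sum1_card /=.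
rewrite (eq_bigl (fun i : 'I_m => (a <= i)%N && (i < b)%N))//.
rewrite -(big_ord_widen_cond _ (fun i => a <= i)%N (fun=> 1%N) bm).
transitivity (\sum_(a <= i < b) 1)%N; first by rewrite big_geq_mkord.
by rewrite sum_nat_const_nat muln1.
Qed.

Section scan_test.
Context {R : realType}.
Local Notation mfun f := (measurable_fun setT (f : coordT -> R)).
Variables (K N n : nat).
Hypothesis K_gt0 : (0 < K)%N.
Hypothesis levN : (lev K N <= n.+1)%N.
Implicit Types (j q : nat) (x : vert n.+1 -> R) (mu : R).

Local Notation c := (Num.sqrt (ln 2 *+ 2) : R).

Let ln2_gt0 : 0 < ln 2 :> R.
Proof. by rewrite ln_gt0// ltr1n. Qed.

Let sqr_c : c ^+ 2 = 2 * ln 2.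
Proof. by rewrite sqr_sqrtr ?mulr_natl// mulrn_wge0// ltW. Qed.

Let a j : nat := (lev K j + K)%N.

Let a_gt0 j : 0 < (a j)%:R :> R.
Proof. by rewrite ltr0n addn_gt0 K_gt0 orbT. Qed.

Definition block j : pred 'I_n.+1 := [pred i : 'I_n.+1 | lev K j <= i < lev K j.+1]%N.

Let card_blockE j : (j < N)%N -> #|block j| = (2 * a j ^ 2)%N.
Proof.
move=> jN; rewrite card_block; first by rewrite /= addKn.
exact: leq_trans (lev_homo _ jN) levN.
Qed.

(** The centred block sum multiplied by [c]: the moment of order [c] becomes [expR] of the score,
    and the threshold becomes [a j * ln 2], since [c ^+ 2 / 2 = ln 2]. *)
Definition score j q x : R :=
  \sum_(i < n.+1 | block j i) (c * x (anc q i) - c ^+ 2).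

(** Here [k] is a position on the last level of block [j], represented by its leftmost descendant
    leaf. The union bound thus counts only the paths down to the end of the block. *)
Definition scan_test x : bool :=
  [exists j : 'I_N, exists k : 'I_(2 ^ (lev K j.+1).-1),
     (a j)%:R * ln 2 <= score j (k * 2 ^ (n.+1 - lev K j.+1)) x].

Lemma measurable_score j q : mfun (score j q).
Proof. exact: measurable_path_sum. Qed.

Lemma coord_sigma_exists (V I : finType) (b : I -> (V -> R) -> bool) :
  (forall i, coord_sigma [set x | b i x]) -> coord_sigma [set x | [exists i, b i x]].
Proof.
move=> mb; rewrite (_ : [set x | _] = \bigcup_(i in [set: I]) [set x | b i x]).
  apply: (@fin_bigcup_measurable _ (@coordT R V)) => //.
  by move=> i _; exact: mb.
by apply/seteqP; split => x /= => [/existsP[i bi]|[i _ bi]];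
  [exists i|apply/existsP; exists i].
Qed.

Lemma is_test_scan : is_test scan_test.
Proof.
apply: coord_sigma_exists => j; apply: coord_sigma_exists => k.
have := @coord_sigma_itv R _ _ `[(a j)%:R * ln 2, +oo[
  (measurable_score j (k * 2 ^ (n.+1 - lev K j.+1))).
by congr (coord_sigma _); apply/seteqP; split => x; rewrite /= in_itv /= andbT.
Qed.

Let expR_Nln2 : expR (- ln 2) = 2^-1 :> R.
Proof. by rewrite expRN lnK// posrE. Qed.

(** Each of the [2 * a j ^ 2] vertices contributes [c ^+ 2 / 2 - c ^+ 2 = - ln 2]. *)
Lemma Egauss_score0 j q : (j < N)%N ->
  Egauss (fun=> 0) (fun x => expR (score j q x - (a j)%:R * ln 2)) =
  (2^-1 ^+ (2 * a j ^ 2 + a j))%:E.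
Proof.
move=> jN.
have -> : (fun=> 0) = mean_path 0 (path_of q) :> (vert n.+1 -> R).
  by apply/funext => v; rewrite mean_path_of mul0r.
under eq_Egauss do rewrite addrC expRD /score.
rewrite (EgaussZ _ (measurable_expR_path_sum _ _ _ _) (fun=> expR_ge0 _))//.
rewrite Egauss_path_expR card_blockE// -EFinM -expRD sqr_c.
rewrite -[X in _ = (X ^+ _)%:E]expR_Nln2 -expRM_natl.
by congr (expR _)%:E; rewrite -[_ *+ (2 * _)]mulr_natl natrD; field.
Qed.

Lemma scan_test_type1 :
  (Egauss (fun=> 0%R) (fun x => (scan_test x)%:R)%R <= (N%:R * 2^-1 ^+ K)%:E)%E.
Proof.
pose e (j : 'I_N) (k : 'I_(2 ^ (lev K j.+1).-1)) x :=
  expR (score j (k * 2 ^ (n.+1 - lev K j.+1)) x - (a j)%:R * ln 2).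
have me (j : 'I_N) k : mfun (e j k).
  apply: measurableT_comp => //; apply: measurable_funB => //.
  exact: measurable_score.
have e0 (j : 'I_N) k x : 0 <= e j k x by exact: expR_ge0.
apply: (@le_trans _ _ (Egauss (fun=> 0%R) (fun x => \sum_j \sum_k e j k x)%R)).
  apply: Egauss_le => //.
  - exact: measurable_bool is_test_scan.
  - by apply: measurable_sum => j; exact: measurable_sum.
  move=> x; case: (boolP (scan_test x)) => [/existsP[j /existsP[k jk]]|_]; last first.
    by rewrite sumr_ge0// => j _; rewrite sumr_ge0.
  rewrite (bigD1 j)//= (bigD1 k)//= -addrA; apply: ler_wpDr.
    by rewrite addr_ge0 ?sumr_ge0// => i _; rewrite sumr_ge0.
  by rewrite -expR0 ler_expR subr_ge0.
rewrite Egauss_sum; last 2 first.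
- by move=> j; exact: measurable_sum.
- by move=> j x; rewrite sumr_ge0.
apply: (@le_trans _ _ (\sum_(j < N) (2^-1 ^+ K)%:E)%E); last first.
  by rewrite sumEFin sumr_const card_ord mulr_natl.
apply: lee_sum => j _; rewrite Egauss_sum//.
under eq_bigr do rewrite Egauss_score0//.
rewrite sumEFin sumr_const card_ord lee_fin -[_ *+ (2 ^ _)]mulr_natr.
(* The exponent is [lev K j.+1 + K]: its first part absorbs the number of scanned paths, and
   [2^-1 ^+ K] remains. *)
rewrite /a addnA [X in _ ^+ (X + _)%N]addnC exprD mulrAC.
rewrite ler_piMl ?exprn_ge0// exprVn ler_pdivrMl ?exprn_gt0// mulr1 -natrX ler_nat.
by rewrite leq_exp2l//= leq_pred.
Qed.

(** This scaling gives the centred block sum the variance [2 * c ^+ 2 = 4 * ln 2], the same for all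
    blocks. *)
Let lambda j : R := c / (a j)%:R.

Lemma Egauss_block_expR mu j q (t : R) : (j < N)%N ->
  Egauss (mean_path mu (path_of q)) (fun x => expR (\sum_(i < n.+1 | block j i)
    (t * lambda j * x (anc q i) - t * lambda j * mu))) = (expR (2 * t ^+ 2 * ln 2))%:E.
Proof.
move=> jN; rewrite Egauss_path_expR card_blockE//; congr (expR _)%:E.
rewrite -mulr_natr natrM natrX /lambda.
have : c ^+ 2 = 2 * ln 2 := sqr_c.
have : (a j)%:R != 0 :> R by rewrite gt_eqF.
move: c (a j)%:R => s b b0 s2.
transitivity (t ^+ 2 * s ^+ 2); first by field.
by rewrite s2; ring.
Qed.

Lemma low_score_prob mu j q : c <= mu -> (j < N)%N ->
  (Egauss (mean_path mu (path_of q)) (fun x => (score j q x < (a j)%:R * ln 2)%R%:R)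
    <= (63 / 64)%:E)%E.
Proof.
move=> cmu jN.
set E := Egauss _; set h := fun x => _%:R.
(* Paley-Zygmund for [w], which has mean 4 and second moment 256. *)
pose w x := expR (\sum_(i < n.+1 | block j i)
    (1 * lambda j * x (anc q i) - 1 * lambda j * mu)).
pose w2 x := expR (\sum_(i < n.+1 | block j i)
    (2 * lambda j * x (anc q i) - 2 * lambda j * mu)).
have mw : mfun w by exact: measurable_expR_path_sum.
have mw2 : mfun w2 by exact: measurable_expR_path_sum.
have w0 x : 0 <= w x by exact: expR_ge0.
have w20 x : 0 <= w2 x by exact: expR_ge0.
have w2E x : w2 x = w x ^+ 2.
  rewrite /w2 /w -expRM_natl; congr expR; rewrite -mulr_natl mulr1 mulr_sumr.
  by apply: eq_bigr => i _; ring.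
have Ew : E w = 4%:E.
  rewrite /E /w Egauss_block_expR//; congr _%:E.
  have -> : 2 * 1 ^+ 2 * ln 2 = 2%:R * ln 2 :> R by ring.
  by rewrite expRM_natl lnK ?posrE//; ring.
have Ew2 : E w2 = (2 ^+ 8)%:E.
  rewrite /E /w2 Egauss_block_expR//; congr _%:E.
  have -> : 2 * 2 ^+ 2 * ln 2 = 8%:R * ln 2 :> R by ring.
  by rewrite expRM_natl lnK ?posrE.
have mh : mfun h.
  have := @coord_sigma_itv R _ _ `]-oo, (a j)%:R * ln 2[ (measurable_score j q).
  move=> /measurable_bool; apply: eq_measurable_fun => x _.
  by rewrite in_itv.
have h0 x : 0 <= h x by rewrite /h ler0n.
have l0 : 0 <= lambda j by rewrite divr_ge0 ?sqrtr_ge0.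
(* The value 1/128 maximises [4 * u - 256 * u ^+ 2], the gain obtained by taking expectations in
   [hw]. *)
have [u u128] : exists u : R, 2 ^+ 7 * u = 1 by exists (2 ^+ 7)^-1; rewrite divff.
have u0 : 0 <= u by rewrite -(pmulr_rge0 _ (exprn_gt0 7 (ltr0n R 2))) u128.
have hw x : h x + 2 * u * w x <= 1 + 4 * u + u ^+ 2 * w2 x.
  rewrite w2E /h; case: ltP => [sx|_] /=.
    (* A low score forces [ln (w x) <= score / a j < ln 2], because centring at [mu >= c] only
       lowers the sum. *)
    have wx2 : w x <= 2.
      rewrite -[leRHS](@lnK R) ?posrE// ler_expR.
      apply: (@le_trans _ _ (score j q x / (a j)%:R)); last first.
        by rewrite ler_pdivrMr// mulrC ltW.
      rewrite /score mulr_suml; apply: ler_sum => i _.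
      have -> : (c * x (anc q i) - c ^+ 2) / (a j)%:R =
         1 * lambda j * x (anc q i) - lambda j * c by rewrite /lambda; ring.
      by rewrite lerB// mul1r ler_wpM2l.
    have : 0 <= u * (2 - w x) by rewrite mulr_ge0// subr_ge0.
    by have := sqr_ge0 (u * w x); rewrite exprMn; lra.
  by have := sqr_ge0 (u * w x - 1); rewrite sqrrB exprMn; lra.
have mh' : mfun (fun x => h x + 2 * u * w x).
  by apply: measurable_funD => //; exact: measurable_funM.
have mw2' : mfun (fun x => u ^+ 2 * w2 x) by exact: measurable_funM.
have uw0 x : 0 <= 2 * u * w x by rewrite !mulr_ge0.
have uw20 x : 0 <= u ^+ 2 * w2 x by rewrite mulr_ge0// sqr_ge0.
have c0 : 0 <= 1 + 4 * u by rewrite addr_ge0// mulr_ge0.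
have : (E h + (8 * u)%:E <= (1 + 6 * u)%:E)%E.
  have -> : (8 * u)%:E = E (fun x => 2 * u * w x).
    rewrite /E (EgaussZ _ mw w0); last by rewrite mulr_ge0.
    by rewrite -/E Ew -EFinM; congr _%:E; ring.
  rewrite /E -(EgaussD _ mh _ h0 uw0); last exact: measurable_funM.
  have -> : (1 + 6 * u)%:E = E (fun x => 1 + 4 * u + u ^+ 2 * w2 x).
    rewrite /E (EgaussD _ _ mw2' _ uw20)//.
    rewrite Egauss_cst// (EgaussZ _ mw2 w20); last by rewrite sqr_ge0.
    rewrite -/E Ew2 -EFinM -EFinD; congr _%:E.
    have -> : u ^+ 2 * 2 ^+ 8 = 2 * u * (2 ^+ 7 * u) by ring.
    by rewrite u128; ring.
  apply: Egauss_le => //.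
  - by apply: measurable_funD.
  - by move=> x; rewrite addr_ge0.
have : (0 <= E h)%E by exact: Egauss_ge0.
have -> : 63 / 64 = 1 - 2 * u.
  by apply: (@mulfI _ (2 ^+ 6)); [exact: expf_neq0|rewrite mulrBr; lra].
by case: (E h) => [r||]//=; rewrite -EFinD !lee_fin => _; lra.
Qed.

Lemma score_free q j (v : vert n.+1) :
  (tag v < lev K j)%N || (lev K j.+1 <= tag v)%N -> free_of v (score j q).
Proof.
move=> vj x y; rewrite /score; apply: eq_bigr => i /andP[ji ij].
rewrite /upd; case: eqP => // iv; move: vj.
by rewrite -iv tag_anc ltnNge ji /= leqNgt ij.
Qed.

(** Induction on the number of blocks: the earlier scores depend on levels below [lev K J], the new
    one on levels from [lev K J] on, so the probabilities multiply. *)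
Lemma all_scores_low_prob mu q J : c <= mu -> (J <= N)%N ->
  (Egauss (mean_path mu (path_of q))
     (fun x => \prod_(j < J) (score j q x < (a j)%:R * ln 2)%R%:R)%R
   <= ((63 / 64) ^+ J)%:E)%E.
Proof.
move=> cmu; elim: J => [_|J IH JN].
  under eq_Egauss do rewrite big_ord0.
  by rewrite Egauss_cst.
pose h j x : R := (score j q x < (a j)%:R * ln 2)%R%:R.
have mh j : mfun (h j).
  have := @coord_sigma_itv R _ _ `]-oo, (a j)%:R * ln 2[ (measurable_score j q).
  move=> /measurable_bool; apply: eq_measurable_fun => x _.
  by rewrite in_itv.
have h0 j x : 0 <= h j x by exact: ler0n.
under eq_Egauss do rewrite big_ord_recr /=.
rewrite (@Egauss_indep _ _ _ (fun x => \prod_(j < J) h j x) (h J))//.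
- rewrite exprSr EFinM; apply: lee_pmul.
  + by apply: Egauss_ge0 => x; rewrite prodr_ge0.
  + exact: Egauss_ge0.
  + by apply: IH; exact: ltnW.
  + exact: low_score_prob.
- exact: measurable_prod.
- by move=> x; rewrite prodr_ge0.
- move=> v; have [vJ|Jv] := ltnP (tag v) (lev K J).
    by right=> x y; rewrite /h score_free// vJ.
  left=> x y; apply: eq_bigr => j _; rewrite /h score_free//.
  by rewrite (leq_trans (lev_homo K (ltn_ord j)) Jv) orbT.
Qed.

(** A block score sees only the ancestor of [q] at the last level of the block, so the score of the
    true path is among the scanned ones. *)
Lemma score_anc j q : (j < N)%N ->
  score j q = score j (q %/ 2 ^ (n.+1 - lev K j.+1) * 2 ^ (n.+1 - lev K j.+1)).
Proof.
move=> jN; have lj : (lev K j.+1 <= n.+1)%N := leq_trans (lev_homo _ jN) levN.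
apply/funext => x; apply: eq_bigr => i /andP[_ ij].
rewrite /anc /=.
have -> : (n - i = (n.+1 - lev K j.+1) + ((lev K j.+1).-1 - i))%N.
  move: ij lj; case: (lev K j.+1) => // l; rewrite !ltnS subSS /= => il ln.
  by rewrite addnBA// subnK.
by rewrite expnD !divnMA mulnK// expn_gt0.
Qed.

Lemma scan_test_type2 mu q : c <= mu -> (q < 2 ^ n)%N ->
  (Egauss (mean_path mu (path_of q)) (fun x => (~~ scan_test x)%:R)%R
    <= ((63 / 64) ^+ N)%:E)%E.
Proof.
move=> cmu qn; apply: le_trans (all_scores_low_prob q cmu (leqnn N)).
apply: Egauss_le => //.
- exact: measurable_negb is_test_scan.
- apply: measurable_prod => j _.
  have := @coord_sigma_itv R _ _ `]-oo, (a j)%:R * ln 2[ (measurable_score j q).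
  move=> /measurable_bool; apply: eq_measurable_fun => x _.
  by rewrite in_itv.
move=> x; rewrite (prod_natr_bool R (fun j : 'I_N => score j q x < (a j)%:R * ln 2)).
case: (boolP (scan_test x)) => [_|nT]; first exact: ler0n.
suff -> : [forall j : 'I_N, score j q x < (a j)%:R * ln 2] by [].
apply/forallP => j; rewrite ltNge; apply: contra nT => jx.
have lj : (lev K j.+1 <= n.+1)%N := leq_trans (lev_homo _ (ltn_ord j)) levN.
have kn : (q %/ 2 ^ (n.+1 - lev K j.+1) < 2 ^ (lev K j.+1).-1)%N.
  rewrite ltn_divLR ?expn_gt0// -expnD (leq_trans qn)// leq_exp2l//.
  have l0 : (0 < lev K j.+1)%N by rewrite /= addn_gt0 muln_gt0 expn_gt0 addn_gt0 K_gt0 !orbT.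
  by rewrite -[X in (_ <= X)%N]/(_ + _)%N -ltnS -addSn prednK// subnKC.
apply/existsP; exists j; apply/existsP; exists (Ordinal kn).
by rewrite /= -score_anc.
Qed.

Lemma scan_test_risk mu : c <= mu ->
  (risk mu scan_test <= (N%:R * 2^-1 ^+ K + (63 / 64) ^+ N)%:E)%E.
Proof.
move=> cmu; rewrite EFinD; apply: leeD.
  by rewrite gauss_prob_bool; exact: scan_test_type1.
apply: ge_ereal_sup => _ [p /tree_path_ofP[q qn ->] <-].
by rewrite gauss_prob_bool; exact: scan_test_type2.
Qed.

End scan_test.

(** * Existence of a powerful sequence of tests *)

Section powerful_tests.
Context {R : realType}.

Lemma risk_ge0 n (mu : R) (T : (vert n.+1 -> R) -> bool) :
  is_test T -> (0 <= risk mu T)%E.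
Proof.
move=> mT; apply: le_trans (risk_ge mu mT); apply: Egauss_ge0 => x.
by rewrite addr_ge0// mulr_ge0//; apply: avg_ge0 => q y; exact: lik_ge0.
Qed.

Lemma small_risk_test (mu e : R) : Num.sqrt (ln 2 *+ 2) <= mu -> 0 < e ->
  exists M, forall m, (M <= m)%N ->
    exists2 T : (vert m -> R) -> bool, is_test T & (risk mu T <= e%:E)%E.
Proof.
move=> cmu e0; have e20 : 0 < e / 2 by rewrite divr_gt0.
(* The number of blocks is fixed first by the type II error; [K] is then chosen large in terms of
   [N] for the type I error. *)
have [N _ /(_ N (leqnn N)) /= Ne] : \forall N \near \oo, (63 / 64 : R) ^+ N < e / 2.
  by apply: cvgr_lt e20; apply: cvg_expr; rewrite ger0_norm; lra.
have [K0 _ /(_ K0.+1 (leqnSn K0)) /= Ke] :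
    \forall K \near \oo, N%:R * (2^-1 : R) ^+ K < e / 2.
  apply: cvgr_lt e20; rewrite -(mulr0 N%:R); apply: cvgM; first exact: cvg_cst.
  by apply: cvg_expr; rewrite ger0_norm; lra.
exists (lev K0.+1 N).+1 => -[//|m] /ltnW Mm.
exists (@scan_test R K0.+1 N m); first exact: is_test_scan.
apply: le_trans (scan_test_risk (ltn0Sn K0) Mm cmu) _.
by rewrite lee_fin; lra.
Qed.

(** One test attains every precision [1 / (i + 1)], [i <= k], that is attainable at depth [m]: the
    finest one serves for all coarser ones. No explicit rate for [N] and [K] in [m] is then
    required. *)
Lemma near_optimal_test (mu : R) m k :
  exists2 T : (vert m -> R) -> bool, is_test T &
    forall i, (i <= k)%N ->
      (exists2 T' : (vert m -> R) -> bool, is_test T' & (risk mu T' <= i.+1%:R^-1%:E)%E) ->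
      (risk mu T <= i.+1%:R^-1%:E)%E.
Proof.
elim: k => [|k [T mT IH]]; last first.
  have [[T' mT' rT']|nT] := pselect (exists2 T' : (vert m -> R) -> bool,
      is_test T' & (risk mu T' <= k.+2%:R^-1%:E)%E).
    exists T' => // i ik _; apply: (le_trans rT'); rewrite lee_fin.
    by rewrite lef_pV2 ?posrE ?ltr0n// ler_nat.
  by exists T => // i; rewrite leq_eqVlt => /predU1P[->//|]; exact: IH.
have [[T' mT' rT']|nT] := pselect (exists2 T' : (vert m -> R) -> bool,
    is_test T' & (risk mu T' <= 1%:R^-1%:E)%E).
  by exists T' => // -[].
exists (fun=> false); last by case.
rewrite /is_test (_ : [set x | _] = set0); last by apply/seteqP; split.
exact: (@measurable0 _ (@coordT R (vert m))).
Qed.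

(** Diagonal choice [k = m]: a given precision is both considered and attainable once [m] is
    large. *)
Lemma powerful_tests (mu : R) : Num.sqrt (ln 2 *+ 2) <= mu ->
  exists T : forall m, (vert m -> R) -> bool,
    (forall m, is_test (T m)) /\ (risk mu (T m) @[m --> \oo] --> (0:R)%:E).
Proof.
move=> cmu; pose T m := sval (cid2 (near_optimal_test mu m m)).
exists T; split => [m|]; first by rewrite /T; case: cid2.
have small (e : R) : 0 < e ->
    \forall m \near \oo, (0 <= risk mu (T m))%E /\ (risk mu (T m) < e%:E)%E.
  move=> e0; pose k := Num.truncn e^-1.
  have ke : (k.+1%:R : R)^-1 < e by rewrite invf_plt ?posrE ?ltr0n// Num.Theory.truncnS_gt.
  have k0 : 0 < (k.+1%:R : R)^-1 by rewrite invr_gt0 ltr0n.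
  have [M HM] := small_risk_test cmu k0.
  exists (maxn k M).+1 => // -[//|n] /= /ltnW; rewrite geq_max => /andP[kn Mn].
  rewrite /T; case: cid2 => T' mT' /= oT'; split; first exact: risk_ge0.
  by apply: (@le_lt_trans _ _ k.+1%:R^-1%:E); [exact: oT' (HM _ Mn)|rewrite lte_fin].
apply/fine_cvgP; split.
  have [N _ h] := small 1 ltr01; exists N => // m /h [r0 r1].
  by rewrite ge0_fin_numE// (lt_trans r1)// ltry.
apply/cvgrPdist_lt => e /small [N _ h]; exists N => // m /h /= [r0 re].
have rf : risk mu (T m) \is a fin_num by rewrite ge0_fin_numE// (lt_trans re)// ltry.
by rewrite sub0r normrN ger0_norm ?fine_ge0// -lte_fin fineK.
Qed.

End powerful_tests.

Theorem theorem1p3 (R : realType) :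
  (* (i) *)
  (forall mu : R, Num.sqrt (ln 2 *+ 2) <= mu ->
     exists T : forall m, (vert m -> R) -> bool,
       (forall m, is_test (T m)) /\ (risk mu (T m) @[m --> \oo] --> (0:R)%:E)) /\
  (* (ii) *)
  (forall mu : R, 0 < mu -> mu < Num.sqrt (ln 2 *+ 2) ->
     forall T : forall m, (vert m -> R) -> bool,
       (forall m, is_test (T m)) -> ~ (risk mu (T m) @[m --> \oo] --> (0:R)%:E)) /\
  (* (iii) *)
  (forall mu : nat -> R, (forall m, 0 < mu m) -> mu @ \oo --> 0 ->
     forall T : forall m, (vert m -> R) -> bool,
       (forall m, is_test (T m)) ->
       (1 <= limn_einf (fun m => risk (mu m) (T m)))%E).
Proof.
split; first exact: powerful_tests.
split; first by move=> mu mu0 mus T mT; exact: no_powerful_test.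
by move=> mu _ mu0 T mT; exact: limn_einf_risk.
Qed.
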